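(* Let $\lambda\in\mathcal{D}$. Assume that the subgroup of $\mathbb{Z}^r$ generated by $\{(F_1(x),\dots,F_r(x)):x\in\Lambda\}$ is all of $\mathbb{Z}^r$. Suppose that there are $\lambda_N\in\mathcal{D}$ ($N\geq1$) such that $\lambda_N\to\lambda$ as $N\to+\infty$. For each $N\ge 1$ let $n_N=(n_{N,1},\dots,n_{N,r})\in\mathbb{Z}^r$, put $E_N=\sum_{j=1}^r a_jn_{N,j}$, and assume that $n_N$ is reachable, i.e. that the set $\Gamma_N(E_N)=\{x\in\Lambda^N:H_N(x)=E_N\}$ is non-empty. Assume moreover that $$n_N-N\mathbf{m}(\lambda_N)=O(1),\quad N\to+\infty.$$ Let $\mu^{\mathrm{sh}}_{N,E_N}$ be the uniform probability measure on $\Gamma_N(E_N)$. Then for every $k\geq1$, $$\left\|(\pi_k)_*\mu^{\mathrm{sh}}_{N,E_N}-\mathbf{p}_{\lambda}^{\otimes k}\right\|_{\mathrm{TV}}\to0,\quad N\to+\infty.$$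
   Context: $\Lambda$ is a free $\mathbb{Z}$-module of finite rank $d\geq1$, $\|\cdot\|$ is a Euclidean norm (coming from an inner product) on $V=\Lambda\otimes_{\mathbb{Z}}\mathbb{R}$, and $H(x)=\|x\|^2$. For $N\geq1$ and $x=(x_1,\dots,x_N)\in\Lambda^N$, $H_N(x)=\sum_{i=1}^N H(x_i)$. Let $G_H\subseteq\mathbb{R}$ be the additive subgroup generated by $\{H(x):x\in\Lambda\}$; it is a finitely generated free abelian group. Let $r$ be its rank and fix a $\mathbb{Z}$-basis $a_1,\dots,a_r$ of $G_H$. Then $F_1,\dots,F_r:\Lambda\to\mathbb{Z}$ are the integer-valued quadratic forms uniquely determined by $H(x)=\sum_{j=1}^r a_jF_j(x)$ for all $x\in\Lambda$. For $\lambda=(\lambda_1,\dots,\lambda_r)\in\mathbb{R}^r$ put $Q_{H,\lambda}(x)=\sum_{j=1}^r\lambda_jF_j(x)$, and let $\mathcal{D}=\{\lambda\in\mathbb{R}^r: Q_{H,\lambda}\text{ is positive definite}\}$, where positive definiteness refers to the extension of the quadratic form to the real vector space $V$. For $\lambda\in\mathcal{D}$ define $\mathcal{Z}(\lambda)=\sum_{x\in\Lambda}e^{-Q_{H,\lambda}(x)}$ (finite), the probability measure $\mathbf{p}_{\lambda}(x)=\mathcal{Z}(\lambda)^{-1}e^{-Q_{H,\lambda}(x)}$ on $\Lambda$, and $\mathbf{m}(\lambda)=\mathbb{E}_{\mathbf{p}_\lambda}[(F_1,\dots,F_r)]\in\mathbb{R}^r$. For $N\geq k$, $\pi_k:\Lambda^N\to\Lambda^k$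 is the projection onto the first $k$ coordinates and $(\pi_k)_*$ denotes push-forward of measures. For probability measures on a countable set, $\|\mu-\nu\|_{\mathrm{TV}}=\sup_A|\mu(A)-\nu(A)|=\frac12\sum_x|\mu(x)-\nu(x)|$. *)

(* Defs.v *)
From HB Require Import structures.
From mathcomp Require Export all_boot all_order all_algebra.
From mathcomp Require Export sesquilinear finmap.
From mathcomp Require Export all_classical all_reals all_analysis.

Set Implicit Arguments.
Unset Strict Implicit.
Unset Printing Implicit Defensive.

Import Order.TTheory GRing.Theory Num.Theory.
Import numFieldNormedType.Exports.

Local Open Scope classical_set_scope.
Local Open Scope ring_scope.

Section Groups.
Variable M : zmodType.

Definition is_subgroup (G : set M) : Prop :=
  G 0 /\ forall x y, G x -> G y -> G (x - y).

Definition generated_subgroup (A : set M) : set M := smallest is_subgroup A.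

(* [b] is a basis of the free abelian group [G], a subgroup of [M]; the rank of
   [G] is then [n]. *)
Definition is_Zbasis (G : set M) (n : nat) (b : 'I_n -> M) : Prop :=
  (forall i, G (b i)) /\
  (forall x, G x -> exists! c : 'rV[int]_n, x = \sum_i b i *~ c 0 i).

End Groups.

Section DiscreteProbability.
Variables (R : realType) (T : choiceType).

(* Every subset is measurable: the probability measure with mass function [p]
   is the set function [A |-> \sum_(x in A) p x]. *)
Definition prob_of (p : T -> R) (A : set T) : R :=
  fine (\esum_(x in A) (p x)%:E).

(* [\sum_x p x * X x], as the sum of the positive parts minus the sum of the
   negative parts since [\esum] is only meaningful for nonnegative families;
   used for absolutely summable families only. *)
Definition expectation_of (p X : T -> R) : R :=
  let f x := (p x * X x)%:E in
  fine (\esum_(x in [set: T]) (f^\+)%E x)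
  - fine (\esum_(x in [set: T]) (f^\-)%E x).

(* For finite nonempty [G]; [fset_set] returns [fset0] on infinite sets. *)
Definition uniform_on (G A : set T) : R :=
  #|` fset_set (A `&` G)|%:R / #|` fset_set G|%:R.

Definition tv_dist (mu nu : set T -> R) : R :=
  sup [set `|mu A - nu A| | A in [set: set T]].

End DiscreteProbability.

Definition push (R : Type) (T U : Type) (f : T -> U) (mu : set T -> R)
  : set U -> R := fun A => mu (f @^-1` A).

Definition product_pmf (R : realType) (T : choiceType) (p : T -> R) (k : nat)
  (x : {ffun 'I_k -> T}) : R := \prod_i p (x i).

Arguments product_pmf {R T} p k x.

(* The first [k] coordinates of [x]. It is meant for [k <= N]; total in [N] (by
   padding with [0] when [N < k]) so that limits in [N] can be taken. *)
Definition proj_first (L : zmodType) (k N : nat) (x : {ffun 'I_N -> L})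
  : {ffun 'I_k -> L} := [ffun i : 'I_k => oapp x 0 (insub (i : nat))].

Arguments proj_first {L} k N x.

Definition shell_energy (R : realType) (r : nat) (a : 'I_r -> R)
  (n : 'rV[int]_r) : R := \sum_j a j * (n 0 j)%:~R.

Section Lattice.
Variables (R : realType) (L : zmodType) (V : vectType R).
Variable iota : {additive L -> V}.

(* Through [iota], [V] is [L (x)_Z R]: the [Z]-basis [e] of [L] is mapped to an
   [R]-basis of [V]. *)
Definition is_extension_of_scalars (d : nat) (e : 'I_d -> L) : Prop :=
  basis_of {:V} (codom (iota \o e)).

Definition euclidean_norm (ip : {dot V for idfun}) (v : V) : R :=
  Num.sqrt (ip v v).

Definition energy (ip : {dot V for idfun}) (x : L) : R :=
  euclidean_norm ip (iota x) ^+ 2.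

Definition energyN (ip : {dot V for idfun}) (N : nat) (x : {ffun 'I_N -> L})
  : R := \sum_i energy ip (x i).

Definition shell (ip : {dot V for idfun}) (N : nat) (E : R)
  : set {ffun 'I_N -> L} := [set x | energyN ip x = E].

Definition energy_group (ip : {dot V for idfun}) : set R :=
  generated_subgroup (range (energy ip)).

(* The quadratic form [Q] on [L] extends uniquely to [V], [L] being of full rank
   in [V]; that extension is positive definite when it is [v |-> B v v] for a
   positive definite symmetric bilinear form [B]. *)
Definition positive_definite (Q : L -> R) : Prop :=
  exists B : {dot V for idfun}, forall x, Q x = B (iota x) (iota x).

Section Gibbs.
Variables (r : nat) (F : L -> 'rV[int]_r).

Definition Qform (lam : 'rV[R]_r) (x : L) : R :=
  \sum_j lam 0 j * (F x 0 j)%:~R.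

Definition Ddomain : set 'rV[R]_r :=
  [set lam | positive_definite (Qform lam)].

Definition partition_function (lam : 'rV[R]_r) : R :=
  fine (\esum_(x in [set: L]) (expR (- Qform lam x))%:E).

Definition gibbs (lam : 'rV[R]_r) (x : L) : R :=
  (partition_function lam)^-1 * expR (- Qform lam x).

Definition mean (lam : 'rV[R]_r) : 'rV[R]_r :=
  \row_j expectation_of (gibbs lam) (fun x => (F x 0 j)%:~R).

End Gibbs.
End Lattice.

Arguments shell {R L V} iota ip N E _.

(* Main.v *)
Require Import Defs.
From HB Require Import structures.
From mathcomp Require Import ring lra.

(** Write p = p_lambda. Since a_1, ..., a_r are independent, the shell is the
    event {sum_i F(x_i) = n_N} of the product measure p^N, on which p^N is
    constant; so the shell measure is p^N conditioned on that event.

    No local limit theorem is needed, only the fact that p^N(shell) is not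
    exponentially small. Indeed, cut N coordinates into B = N/k blocks, let A be
    a set of k-tuples with P = p^k(A), and let mu be its probability under the
    k-marginal of the shell measure. By exchangeability and Jensen,
      exp(theta B (mu - P))
        <= E_shell[exp(theta sum_b (1_A(x_b) - P))]
        <= E_p[exp(theta (1_A - P))]^B / p^N(shell)
        <= exp(2 theta^2 B) / p^N(shell),
    uniformly in A. Apply this to A and to its complement.

    For the lower bound on p^N(shell), keep K = N/D coordinates aside. By a
    Chernoff bound on a large finite subset of the lattice, the other N - K
    coordinates have sum (N - K) m + o(N) with probability at least
    exp(-o(N)); as the F(x) generate Z^r, the missing vector, which is close to
    K m, is a sum of K values of F, and any such completion costs exp(-O(K)).

    The parameters lambda_N enter only through m(lambda_N) -> m(lambda), that is
    n_N = N m(lambda) + o(N). *)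

Set Implicit Arguments.
Unset Strict Implicit.
Unset Printing Implicit Defensive.

Import Order.TTheory GRing.Theory Num.Theory.
Import numFieldNormedType.Exports.

Local Open Scope classical_set_scope.
Local Open Scope ring_scope.

(** * Sums over finite subsets *)

Lemma prod_natb (R : comPzSemiRingType) (J : finType) (P : pred J) :
  \prod_i (P i)%:R = [forall i, P i]%:R :> R.
Proof.
have [/forallP Pt|] := boolP [forall i, P i]; first by rewrite big1 // => i _; rewrite Pt.
by rewrite negb_forall => /existsP[i /negbTE nPi]; rewrite (bigD1 i) //= nPi mul0r.
Qed.

(** Disjoint blocks of coordinates are independent under a product weight. It is an inequality
    because [p] may have mass below 1, as Gibbs weights restricted to a finite set of lattice points
    do. *)
Lemma sum_blocks_le (R : realDomainType) (T I : finType) (B k : nat)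
    (beta : 'I_B -> 'I_k -> I) (p : T -> R) (h : {ffun 'I_k -> T} -> R) :
    (forall b j b' j', beta b j = beta b' j' -> b = b' /\ j = j') ->
    (forall t, 0 <= p t) -> \sum_t p t <= 1 -> (forall y, 0 <= h y) ->
  \sum_(x : {ffun I -> T})
     (\prod_i p (x i)) * \prod_b h [ffun j => x (beta b j)]
  <= (\sum_(y : {ffun 'I_k -> T}) (\prod_j p (y j)) * h y) ^+ B.
Proof.
move=> beta_inj p0 p1 h0.
(* Expand [h] of each block over the possible values [Y b] of that block; for
   given [Y] the sum over [x] factors over the coordinates. *)
pose c (Y : {ffun 'I_B -> {ffun 'I_k -> T}}) i t : bool :=
  [forall b, forall j, (beta b j == i) ==> (t == Y b j)].
have expand (x : {ffun I -> T}) : \prod_b h [ffun j => x (beta b j)] =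
    \sum_(Y : {ffun 'I_B -> {ffun 'I_k -> T}})
      (\prod_b h (Y b)) * \prod_i (c Y i (x i))%:R.
  transitivity (\prod_b \sum_(y : {ffun 'I_k -> T})
      (h y * (y == [ffun j => x (beta b j)])%:R)).
    apply: eq_bigr => b _.
    rewrite (bigD1 [ffun j => x (beta b j)]) //= eqxx mulr1 big1 ?addr0 //.
    by move=> y /negbTE ->; rewrite mulr0.
  rewrite bigA_distr_bigA /=; apply: eq_bigr => Y _; rewrite big_split /=.
  rewrite !prod_natb; congr (_ * _%:R); congr nat_of_bool.
  apply/forallP/forallP => [Yx i|cY b].
    apply/forallP => b; apply/forallP => j; apply/implyP => /eqP <-.
    by rewrite (eqP (Yx b)) ffunE.
  apply/eqP/ffunP => j; rewrite ffunE.
  by have /forallP/(_ b)/forallP/(_ j) := cY (beta b j); rewrite eqxx => /eqP.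
have inner (Y : {ffun 'I_B -> {ffun 'I_k -> T}}) :
    \sum_(x : {ffun I -> T}) \prod_i (p (x i) * (c Y i (x i))%:R)
    <= \prod_b \prod_j p (Y b j).
  rewrite -(bigA_distr_bigA (fun i t => p t * (c Y i t)%:R)) pair_big /=.
  pose bt (u : 'I_B * 'I_k) := beta u.1 u.2.
  have bt_inj : injective bt.
    by move=> [b j] [b' j'] /beta_inj[/= -> ->].
  have F0 i : 0 <= \sum_t p t * (c Y i t)%:R.
    by apply: sumr_ge0 => t _; rewrite mulr_ge0.
  have F1 i : \sum_t p t * (c Y i t)%:R <= 1.
    apply: le_trans p1; apply: ler_sum => t _.
    by case: (c Y i t); rewrite ?mulr1 ?mulr0.
  have Fbt u : \sum_t p t * (c Y (bt u) t)%:R <= p (Y u.1 u.2).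
    rewrite (bigD1 (Y u.1 u.2)) //= big1 ?addr0 => [|t tY].
      by case: (c _ _ _); rewrite ?mulr1 ?mulr0.
    suff -> : c Y (bt u) t = false by rewrite mulr0.
    apply/negP => /forallP/(_ u.1)/forallP/(_ u.2).
    by rewrite eqxx (negbTE tY).
  (* A coordinate inside a block is pinned to one value, so its sum is at most [p] of that value; a
     coordinate outside all blocks contributes at most 1. *)
  rewrite (bigID [in codom bt]) /= -[leRHS]mulr1.
  apply: ler_pM; try by apply: prodr_ge0.
    rewrite (_ : \prod_(i in codom bt) _ =
                 \prod_u \sum_t p t * (c Y (bt u) t)%:R); last first.
      rewrite -(big_map bt predT (fun i => \sum_t p t * (c Y i t)%:R)).
      rewrite big_uniq /=; first by apply: eq_bigl => i; rewrite codomE enumT.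
      by rewrite map_inj_uniq // index_enum_uniq.
    by apply: ler_prod => u _; rewrite sumr_ge0 ?Fbt // => t _; rewrite mulr_ge0.
  by apply: prodr_ile1 => i _; rewrite F0 F1.
under eq_bigr => x _ do rewrite expand mulr_sumr.
rewrite exchange_big /=.
rewrite -[B in _ ^+ B]card_ord -prodr_const bigA_distr_bigA /=.
apply: ler_sum => Y _.
under eq_bigr => x _ do rewrite mulrCA -big_split.
by rewrite -mulr_sumr mulrC big_split /= ler_wpM2r ?inner // prodr_ge0.
Qed.

Lemma ler_sum_uniq (R : numDomainType) (T : eqType) (s1 s2 : seq T) (f : T -> R) :
  (forall x, 0 <= f x) -> uniq s1 -> {subset s1 <= s2} ->
  \sum_(x <- s1) f x <= \sum_(x <- s2) f x.
Proof.
move=> f0; elim: s1 s2 => [|x s1 IH] s2 /=; first by rewrite big_nil sumr_ge0.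
move=> /andP[xs1 us1] s12; have xs2 : x \in s2 by rewrite s12 ?mem_head.
rewrite (perm_big _ (perm_to_rem xs2)) !big_cons lerD2l IH // => y ys1.
have := s12 y; rewrite (perm_mem (perm_to_rem xs2)) !inE ys1 orbT => /(_ isT).
by case/predU1P => // yx; rewrite -yx ys1 in xs1.
Qed.

(** Finitely many tuples use finitely many coordinate values, so they all lie in one full product
    over a finite [X], where sums of products factor. *)
Lemma sum_fset_ffun_le (R : numDomainType) (L : choiceType) (I : finType)
    (Y : {fset {ffun I -> L}}) (g : {ffun I -> L} -> R) : (forall y, 0 <= g y) ->
  exists X : {fset L},
    \sum_(y <- Y) g y <= \sum_(f : {ffun I -> X}) g [ffun i => val (f i)].
Proof.
move=> g0; exists [fset x in flatten [seq codom (y : {ffun I -> L}) | y <- Y]]%fset.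
set X := [fset x in _]%fset; pose phi (f : {ffun I -> X}) := [ffun i => val (f i)].
rewrite -(big_map phi predT g); apply: ler_sum_uniq => // y yY.
have yX i : y i \in X.
  by rewrite !inE /=; apply/flattenP; exists (codom y); [exact: map_f | exact: codom_f].
apply/mapP; exists [ffun i => [` yX i]%fset]; first by rewrite mem_index_enum.
by apply/ffunP => i; rewrite !ffunE.
Qed.

(** * Unordered sums of nonnegative families and their finite partial sums *)

Section Esum.
Variables (R : realType) (T : choiceType) (f : T -> R).
Hypothesis f0 : forall x, 0 <= f x.

Lemma esum_le_bound (A : set T) (M : R) :
  (forall X : {fset T}, [set` X] `<=` A -> \sum_(x <- X) f x <= M) ->
  (\esum_(x in A) (f x)%:E <= M%:E)%E.
Proof.
move=> fM; apply: ge_ereal_sup => _ [X [Xfin XA] <-].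
rewrite fsbig_finite //= sumEFin lee_fin; apply: fM.
by rewrite fset_setK.
Qed.

Lemma fset_le_esum (A : set T) (X : {fset T}) : [set` X] `<=` A ->
  ((\sum_(x <- X) f x)%:E <= \esum_(x in A) (f x)%:E)%E.
Proof.
move=> XA; apply: ereal_sup_ubound; exists [set` X] => //.
by rewrite fsbig_finite //= set_fsetK sumEFin.
Qed.

Lemma esum_approx (A : set T) (eps : R) : 0 < eps ->
  (\esum_(x in A) (f x)%:E \is a fin_num)%E ->
  exists2 X : {fset T}, [set` X] `<=` A &
    fine (\esum_(x in A) (f x)%:E) - eps < \sum_(x <- X) f x.
Proof.
move=> eps0 fin; have [_ [X [Xfin XA] <-]] := ub_ereal_sup_adherent eps0 fin.
rewrite fsbig_finite //= sumEFin -[ereal_sup _]fineK // -EFinB lte_fin => ltX.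
by exists (fset_set X) => //; rewrite fset_setK.
Qed.

Lemma esum_fin_num (A : set T) (M : R) :
  (forall X : {fset T}, [set` X] `<=` A -> \sum_(x <- X) f x <= M) ->
  (\esum_(x in A) (f x)%:E \is a fin_num)%E.
Proof.
move=> fM; rewrite ge0_fin_numE; last by apply: esum_ge0 => x _; rewrite lee_fin.
by apply: le_lt_trans (esum_le_bound fM) _; rewrite ltry.
Qed.

End Esum.

(** * Families dominated by a summable weight *)

Section DominatedSums.
Variables (R : realType) (T : choiceType) (w : T -> R).
Hypothesis w0 : forall x, 0 <= w x.
Hypothesis w_bounded : exists S, forall X : {fset T}, \sum_(x <- X) w x <= S.

(** Outside [X0] the weight [w] has mass below [eps], hence so does every [h] below [w]. Uniformity
    in [h] is what later allows a limit in the parameter. *)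
Lemma esum_fset_approx (eps : R) : 0 < eps -> exists X0 : {fset T},
  forall (X : {fset T}) (h : T -> R), (X0 `<=` X)%fset ->
    (forall x, 0 <= h x <= w x) ->
  `|fine (\esum_(x in [set: T]) (h x)%:E)%E - \sum_(x <- X) h x| <= eps.
Proof.
move=> eps0; have [S wS] := w_bounded.
have wfin := esum_fin_num w0 (fun X (_ : [set` X] `<=` [set: T]) => wS X).
have [X0 _ WX0] := esum_approx eps0 wfin.
set W := fine _ in WX0; have wW (Y : {fset T}) : \sum_(x <- Y) w x <= W.
  by rewrite -lee_fin fineK //; apply: fset_le_esum.
exists X0 => X h X0X hw.
have h0 x : 0 <= h x by have /andP[] := hw x.
have hle x : h x <= w x by have /andP[] := hw x.
have hX (Y : {fset T}) : \sum_(x <- Y) h x <= \sum_(x <- X) h x + eps.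
  have XY : {subset X <= (X `|` Y)%fset} by move=> x xX; rewrite inE xX.
  have YX : {subset Y <= (X `|` Y)%fset} by move=> x xY; rewrite inE xY orbT.
  have hXY := ler_sum_uniq h0 (fset_uniq Y) YX.
  have wh0 x : 0 <= w x - h x by rewrite subr_ge0.
  have := ler_sum_uniq wh0 (fset_uniq X) XY.
  have := ler_sum_uniq w0 (fset_uniq X0) (fsubsetP X0X).
  rewrite !sumrB; have := wW (X `|` Y)%fset.
  lra.
have hfin : (\esum_(x in [set: T]) (h x)%:E \is a fin_num)%E.
  by apply: (esum_fin_num h0) => Y _; exact: hX.
have hub : fine (\esum_(x in [set: T]) (h x)%:E)%E <= \sum_(x <- X) h x + eps.
  by rewrite -lee_fin fineK //; apply: (esum_le_bound) => Y _; exact: hX.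
have hlb : \sum_(x <- X) h x <= fine (\esum_(x in [set: T]) (h x)%:E)%E.
  by rewrite -lee_fin fineK //; apply: fset_le_esum.
rewrite ger0_norm ?subr_ge0 //; lra.
Qed.

Lemma expectation_fset_approx (eps : R) : 0 < eps -> exists X0 : {fset T},
  forall (X : {fset T}) (p g : T -> R), (X0 `<=` X)%fset ->
    (forall x, `|p x * g x| <= w x) ->
  `|expectation_of p g - \sum_(x <- X) p x * g x| <= eps.
Proof.
move=> eps0; have [X0 X0P] := esum_fset_approx (divr_gt0 eps0 (ltr0Sn R 1)).
exists X0 => X p g X0X hw; pose f x := p x * g x.
have pos x : 0 <= Num.max (f x) 0 <= w x.
  rewrite le_max lexx orbT ge_max w0 andbT.
  exact: le_trans (ler_norm _) (hw x).
have neg x : 0 <= Num.max (- f x) 0 <= w x.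
  rewrite le_max lexx orbT ge_max w0 andbT.
  by apply: le_trans (ler_norm _) _; rewrite normrN; exact: hw.
have := X0P _ _ X0X pos; have := X0P _ _ X0X neg.
rewrite /expectation_of.
under [X in fine X - fine _]eq_esum do rewrite funeposE -EFin_max.
under [X in fine _ - fine X]eq_esum do rewrite funenegE -EFinN -EFin_max.
have -> : \sum_(x <- X) p x * g x = \sum_(x <- X) Num.max (f x) 0
                                    - \sum_(x <- X) Num.max (- f x) 0.
  rewrite -sumrB; apply: eq_bigr => x _; rewrite -/(f x).
  have [fx|fx] := orP (le_total 0 (f x)).
    by rewrite (max_l fx) max_r ?oppr_le0 // subr0.
  by rewrite (max_r fx) max_l ?oppr_ge0 // sub0r opprK.
rewrite !ler_norml; set A := fine _; set B := fine _.
set C := \sum_(x <- X) _; set D := \sum_(x <- X) _.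
by move=> /andP[? ?] /andP[? ?]; apply/andP; split; lra.
Qed.

End DominatedSums.

(** Discrete dominated convergence: one finite set serves for almost all [N] and for the limit, and
    on it convergence is termwise. The error is split in three. *)
Lemma cvg_of_fset_approx (R : realType) (T : choiceType) (s : nat -> R) (l : R)
    (f : nat -> T -> R) (g : T -> R) :
  (forall eps, 0 < eps -> exists X : {fset T},
     (\forall N \near \oo, `|s N - \sum_(x <- X) f N x| <= eps) /\
     `|l - \sum_(x <- X) g x| <= eps) ->
  (forall x, f N x @[N --> \oo] --> g x) ->
  s N @[N --> \oo] --> l.
Proof.
move=> approx fg; apply/cvgrPdist_le => eps eps0.
have [X [sX lX]] := approx _ (divr_gt0 eps0 (ltr0Sn R 2)).
have /cvgrPdist_le/(_ _ (divr_gt0 eps0 (ltr0Sn R 2))) fX :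
    \sum_(x <- X) f N x @[N --> \oo] --> \sum_(x <- X) g x.
  by apply: cvg_big => // x; exact: add_continuous.
near=> N.
have : `|s N - \sum_(x <- X) f N x| <= eps / 3%:R by near: N.
have : `|\sum_(x <- X) g x - \sum_(x <- X) f N x| <= eps / 3%:R by near: N.
move: lX; rewrite !ler_norml.
by move=> /andP[? ?] /andP[? ?] /andP[? ?]; apply/andP; split; lra.
Unshelve. all: by end_near.
Qed.

(** * Quadratic forms on the lattice *)

Section DotProduct.
Variables (R : realFieldType) (V : vectType R) (B : {dot V for idfun}).

Lemma dotC u v : B u v = B v u.
Proof. by rewrite (hermC B) expr0 mul1r. Qed.

Lemma dot_ge0 v : 0 <= B v v.
Proof.
have [->|/neq0_dnorm_gt0 h] := eqVneq v 0; first by rewrite linear0l.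
exact: ltW (h _ B).
Qed.

Lemma dot_eq0 v : B v v = 0 -> v = 0.
Proof.
have [//|/neq0_dnorm_gt0 h] := eqVneq v 0.
by move=> e; have := h _ B; rewrite e ltxx.
Qed.

Lemma dot_CauchySchwarz u v : B u v ^+ 2 <= B u u * B v v.
Proof.
have [->|v0] := eqVneq v 0.
  by rewrite linear0r expr0n /= mulr_ge0 ?dot_ge0.
have Bv : 0 < B v v by exact: neq0_dnorm_gt0.
(* Up to the factor [B v v], this is the component of [u] orthogonal to [v]. *)
have := dot_ge0 (B v v *: u - B u v *: v).
rewrite linearBl !linearBr !linearZr_LR !linearZl_LR /= (dotC v u).
rewrite (_ : _ - _ = B v v * (B u u * B v v - B u v ^+ 2)); last by ring.
by rewrite pmulr_rge0 // subr_ge0.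
Qed.

(** The Gram matrix is invertible, which yields a dual family [w] with [c i = B v (w i)];
    Cauchy-Schwarz then bounds the coordinate. *)
Lemma coord_sqr_le_dot n (X : n.-tuple V) : basis_of fullv X ->
  exists2 C, 0 < C & forall (c : 'I_n -> R) i,
    c i ^+ 2 <= C * B (\sum_j c j *: X`_j) (\sum_j c j *: X`_j).
Proof.
move=> Xbasis; pose G : 'M[R]_n := \matrix_(i, j) B X`_i X`_j.
have Gfree : row_free G.
  apply: inj_row_free => u uG; set w := \sum_j u 0 j *: X`_j.
  have wX (j : 'I_n) : B w X`_j = 0.
    have /rowP/(_ j) := uG; rewrite !mxE => <-.
    by rewrite linear_sumlz; apply: eq_bigr => i _; rewrite linearZl_LR mxE.
  have w0 : w = 0.
    apply: dot_eq0; rewrite {2}/w linear_sumr big1 // => j _.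
    by rewrite linearZr_LR /= wX mulr0.
  apply/rowP => i; rewrite mxE.
  exact: (freeP (basis_free Xbasis) (fun i => u 0 i) w0).
have /row_freeP[H GH] := Gfree.
pose w (i : 'I_n) := \sum_j H j i *: X`_j.
exists (1 + \sum_i B (w i) (w i)).
  by rewrite ltr_pwDl // sumr_ge0 // => i _; rewrite dot_ge0.
move=> c i; set v : V := \sum_j c j *: _.
have -> : c i = B v (w i).
  rewrite linear_sumlz; under eq_bigr => j _ do
    rewrite linearZl_LR /= linear_sumr /=.
  rewrite (bigD1 i) //= [X in _ + X]big1 ?addr0 => [|l /negbTE li].
    have /matrixP/(_ i i) := GH; rewrite !mxE eqxx mulr1n => GH1.
    rewrite -[LHS]mulr1 -[in LHS]GH1; congr (_ * _).
    by apply: eq_bigr => j _; rewrite linearZr_LR mxE mulrC.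
  have /matrixP/(_ l i) := GH; rewrite !mxE li mulr0n => GH0.
  rewrite -[RHS](mulr0 (c l)) -[in RHS]GH0; congr (_ * _).
  by apply: eq_bigr => j _; rewrite linearZr_LR mxE mulrC.
apply: le_trans (dot_CauchySchwarz _ _) _; rewrite mulrC.
rewrite ler_wpM2r ?dot_ge0 // (bigD1 i) //= addrCA lerDl.
by rewrite addr_ge0 // sumr_ge0 // => j _; rewrite dot_ge0.
Qed.

End DotProduct.

(** * Generated subgroups and bases over the integers *)

Section Subgroups.
Variable M : zmodType.

Lemma generated_subgroup_is_subgroup (A : set M) :
  is_subgroup (generated_subgroup A).
Proof.
split=> [G [[G0 _] _] //|x y Ax Ay G [Gs AG]].
by apply: Gs.2; [apply: Ax | apply: Ay].
Qed.

Lemma subgroup_sumMz (G : set M) (I : finType) (b : I -> M) (c : I -> int) :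
  is_subgroup G -> (forall i, G (b i)) -> G (\sum_i b i *~ c i).
Proof.
move=> [G0 GB] Gb.
have GN x : G x -> G (- x) by rewrite -(sub0r x); exact: GB.
have GD x y : G x -> G y -> G (x + y).
  by move=> Gx Gy; rewrite -(opprK y); apply: GB => //; exact: GN.
have GMn x n : G x -> G (x *+ n).
  by move=> Gx; elim: n => [|n IH]; rewrite ?mulr0n ?mulrS //; exact: GD.
elim/big_ind: _ => // i _; case: (c i) => n; first exact: GMn.
by rewrite NegzE mulrNz; apply/GN/GMn.
Qed.

Lemma Zbasis_inj (G : set M) n (b : 'I_n -> M) (c c' : 'rV[int]_n) :
  is_subgroup G -> is_Zbasis G b ->
  \sum_i b i *~ c 0 i = \sum_i b i *~ c' 0 i -> c = c'.
Proof.
move=> Gs [Gb uniqb] e; have Gx := subgroup_sumMz (fun i => c 0 i) Gs Gb.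
by have [c0 [_ c0P]] := uniqb _ Gx; rewrite -(c0P _ (erefl _)) -(c0P _ e).
Qed.

End Subgroups.

Lemma sum_geometric_le (R : realFieldType) (q : R) n : 0 <= q < 1 ->
  \sum_(i < n) q ^+ i <= (1 - q)^-1.
Proof.
move=> /andP[q0 q1]; rewrite -[leRHS]mul1r ler_pdivlMr ?subr_gt0 //.
have -> : (\sum_(i < n) q ^+ i) * (1 - q) = 1 - q ^+ n.
  by rewrite mulrC -[1 - q]opprB mulNr -subrX1 opprB.
by rewrite gerBl exprn_ge0.
Qed.

Lemma sum_fset_int_geometric_le (R : realFieldType) (q : R) (X : {fset int}) :
  0 <= q < 1 -> \sum_(z <- X) q ^+ `|z|%N <= (1 - q)^-1 *+ 2.
Proof.
move=> q01; have /andP[q0 _] := q01.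
have [n nP] : exists n, forall z, z \in X -> (`|z| < n)%N.
  by exists (\max_(z <- X) `|z|%N).+1 => z zX; rewrite ltnS; apply: leq_bigmax_seq.
(* The enumerating list contains 0 twice, which is harmless for an upper bound. *)
apply: (@le_trans _ _ (\sum_(z <- [seq Posz i | i <- index_iota 0 n] ++
                             [seq - Posz i | i <- index_iota 0 n]) q ^+ `|z|%N)).
  apply: ler_sum_uniq => [z||z zX]; [exact: exprn_ge0 | exact: fset_uniq |].
  have zn : `|z|%N \in index_iota 0 n by rewrite mem_index_iota nP.
  rewrite mem_cat; apply/orP; case: z {zX} zn => m mn; [left|right].
    exact: (map_f Posz mn).
  by rewrite NegzE; exact: (map_f (fun i => - Posz i) mn).
rewrite big_cat /= !big_map mulr2n !big_mkord.
by under [X in _ + X]eq_bigr => i _ do rewrite abszN; rewrite lerD ?sum_geometric_le.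
Qed.

Lemma mxMz m n (u : 'M[int]_(m, n)) (z : int) i j : (u *~ z) i j = z * u i j.
Proof. by rewrite -(scaler_int z u) mxE intz. Qed.

Section ShellEnergy.
Variables (R : realType) (r : nat) (a : 'I_r -> R).

Lemma shell_energy_is_zmod_morphism : zmod_morphism (shell_energy a).
Proof.
move=> u v; rewrite /shell_energy -sumrB; apply: eq_bigr => j _.
by rewrite !mxE rmorphB mulrBr.
Qed.

HB.instance Definition _ := GRing.isZmodMorphism.Build 'rV[int]_r R
  (shell_energy a) shell_energy_is_zmod_morphism.

End ShellEnergy.

(** * The vector-valued form [F] and its comparison with positive definite forms *)

Section EnergyLattice.
Variables (R : realType) (d : nat) (L : zmodType) (e : 'I_d -> L).
Variables (V : vectType R) (iota : {additive L -> V}).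
Variables (ip : {dot V for idfun}) (r : nat) (a : 'I_r -> R).
Variable F : L -> 'rV[int]_r.
Hypothesis e_basis : is_Zbasis [set: L] e.
Hypothesis V_ext : is_extension_of_scalars iota e.
Hypothesis a_basis : is_Zbasis (energy_group iota ip) a.
Hypothesis F_def : forall x, energy iota ip x = \sum_j a j * (F x 0 j)%:~R.

Lemma energyE x : energy iota ip x = ip (iota x) (iota x).
Proof. by rewrite /energy sqr_sqrtr ?dot_ge0. Qed.

Lemma shell_energy_inj : injective (shell_energy a).
Proof.
move=> u v uv; apply: (Zbasis_inj (generated_subgroup_is_subgroup _) a_basis).
by move: uv; rewrite /shell_energy; under eq_bigr do rewrite mulrzr;
   under [RHS]eq_bigr do rewrite mulrzr.
Qed.

Lemma shell_energyF x : shell_energy a (F x) = energy iota ip x.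
Proof. by rewrite F_def. Qed.

Lemma energy_form0 : F 0 = 0.
Proof.
by apply: shell_energy_inj; rewrite shell_energyF energyE !raddf0.
Qed.

(** As [a] is a basis over the integers, one real equation on the energy amounts to [r] integer
    equations. *)
Lemma shellE N n (x : {ffun 'I_N -> L}) :
  shell iota ip N (shell_energy a n) x <-> \sum_i F (x i) = n.
Proof.
have E : energyN iota ip x = shell_energy a (\sum_i F (x i)).
  by rewrite raddf_sum; apply: eq_bigr => i _; rewrite /= shell_energyF.
by rewrite /shell /= E; split=> [/shell_energy_inj|->].
Qed.

Let b i l := F (e i + e l) - F (e i) - F (e l).

(** Polarization: [shell_energy a] is additive, injective and sends [F] to the squared norm, so the
    identity can be checked on the inner product. The factor 2 reflects that [b i i] is twice
    [F (e i)]. *)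
Lemma energy_form_polar (c : 'I_d -> int) :
  F (\sum_i e i *~ c i) *+ 2 = \sum_i \sum_l b i l *~ (c i * c l).
Proof.
apply: shell_energy_inj; rewrite raddfMn /= shell_energyF energyE.
have iotaE : iota (\sum_i e i *~ c i) = \sum_i (c i)%:~R *: iota (e i).
  by rewrite raddf_sum; apply: eq_bigr => i _; rewrite raddfMz scaler_int.
rewrite iotaE linear_sumlz -sumrMnl raddf_sum; apply: eq_bigr => i _ /=.
rewrite linear_sumr -sumrMnl raddf_sum; apply: eq_bigr => l _ /=.
rewrite linearZl_LR linearZr_LR /= raddfMz /= !raddfB /= !shell_energyF.
rewrite !energyE raddfD linearDl !linearDr /= (dotC ip (iota (e l))).
rewrite -[RHS]mulrzr intrM; ring.
Qed.

Section PositiveDefinite.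
Variables (lam : 'rV[R]_r).
Hypothesis lam_D : Ddomain iota F lam.

Lemma Qform_ge0 x : 0 <= Qform F lam x.
Proof. by have [B ->] := lam_D; exact: dot_ge0. Qed.

Lemma coord_sqr_le_Qform : exists2 C, 0 < C &
  forall (c : 'I_d -> int) i, (c i)%:~R ^+ 2 <= C * Qform F lam (\sum_i e i *~ c i).
Proof.
have [B QB] := lam_D; pose X := [tuple iota (e i) | i < d].
have Xbasis : basis_of fullv X.
  by move: V_ext; rewrite /is_extension_of_scalars /codom /image_mem enumT.
have [C C0 CP] := coord_sqr_le_dot B Xbasis; exists C => // c i.
rewrite QB; have -> : iota (\sum_i e i *~ c i) = \sum_i (c i)%:~R *: X`_i.
  rewrite raddf_sum; apply: eq_bigr => l _.
  by rewrite raddfMz -scaler_int -tnth_nth tnth_mktuple.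
exact: CP.
Qed.

(** By polarization [F] is a quadratic polynomial in the integer coordinates, and a product of two
    coordinates is at most [C * q] because both squares are. *)
Lemma energy_form_le_Qform : exists2 C, 0 < C &
  forall x j, `|(F x 0 j)%:~R| <= C * Qform F lam x.
Proof.
have [C C0 CP] := coord_sqr_le_Qform.
pose D : R := \sum_j \sum_i \sum_l `|(b i l 0 j)%:~R|.
have D0 : 0 <= D by rewrite !sumr_ge0 // => j _; rewrite sumr_ge0 // => i _; rewrite sumr_ge0.
exists (1 + C * D); first by rewrite ltr_pwDl // mulr_ge0 // ltW.
move=> x j; have [c [xE _]] := e_basis.2 x I; rewrite {}xE.
set q := Qform _ _ _.
have q0 : 0 <= q by exact: Qform_ge0.
have cc i l : `|(c 0 i * c 0 l)%:~R| <= C * q.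
  have ci := CP (fun i => c 0 i) i; have cl := CP (fun i => c 0 i) l.
  rewrite -/q in ci cl; rewrite intrM normrM.
  rewrite -real_normK ?num_real // in ci; rewrite -real_normK ?num_real // in cl.
  have := sqr_ge0 (`|(c 0 i)%:~R| - `|(c 0 l)%:~R| : R); nra.
have /(congr1 (fun u : 'rV_r => (u 0 j)%:~R : R)) := energy_form_polar (fun i => c 0 i).
rewrite mulmxnE raddfMn /= summxE raddf_sum /= => F2.
have: `|(F (\sum_i e i *~ c 0 i) 0 j)%:~R *+ 2| <= C * q * D.
  rewrite F2 mulr_sumr (bigD1 j) //=; apply: le_trans (ler_norm_sum _ _ _) _.
  rewrite -[leLHS]addr0 lerD //; last first.
    rewrite sumr_ge0 // => k _; rewrite mulr_ge0 ?mulr_ge0 ?(ltW C0) //.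
    by rewrite sumr_ge0 // => i _; rewrite sumr_ge0.
  rewrite mulr_sumr; apply: ler_sum => i _.
  rewrite summxE raddf_sum mulr_sumr; apply: le_trans (ler_norm_sum _ _ _) _.
  apply: ler_sum => l _ /=.
  have -> : ((b i l *~ (c 0 i * c 0 l)) 0 j)%:~R =
      (c 0 i * c 0 l)%:~R * (b i l 0 j)%:~R :> R.
    by rewrite mxMz intrM.
  by rewrite normrM ler_wpM2r.
rewrite normrMn mulr2n.
have : 0 <= `|(F (\sum_i e i *~ c 0 i) 0 j)%:~R : R| by [].
have := mulr_ge0 (mulr_ge0 (ltW C0) q0) D0.
nra.
Qed.

(** Integers satisfy [|c i| <= c i ^ 2], so [Q] dominates the sum of the [|c i|] up to a constant.
    The weight is then at most a product of geometric terms, one for each coordinate. *)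
Lemma sum_expR_Qform_bounded (eta : R) : 0 < eta -> exists S, forall X : {fset L},
  \sum_(x <- X) expR (- (eta * Qform F lam x)) <= S.
Proof.
move=> eta0; have [C C0 CP] := coord_sqr_le_Qform.
have /boolp.choice[c cE] : forall x, exists c : {ffun 'I_d -> int}, x = \sum_i e i *~ c i.
  move=> x; have [c0 [xE _]] := e_basis.2 x I.
  by exists [ffun i => c0 0 i]; rewrite {1}xE; apply: eq_bigr => i _; rewrite ffunE.
have c_inj : injective c by move=> x y cxy; rewrite (cE x) cxy -cE.
(* Using [d.+1] keeps the denominator positive for every [d]. *)
pose q := expR (- (eta / (C * d.+1%:R))).
have q01 : 0 <= q < 1.
  by rewrite expR_ge0 /= expR_lt1 oppr_lt0 divr_gt0 ?mulr_gt0.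
have le_q x : expR (- (eta * Qform F lam x)) <= \prod_i q ^+ `|c x i|%N.
  under eq_bigr do rewrite /q -expRM_natl.
  rewrite -expR_sum ler_expR; set Q := Qform _ _ _.
  have Q0 : 0 <= Q by exact: Qform_ge0.
  have cQ i : `|c x i|%:R <= C * Q.
    apply: (@le_trans _ _ ((c x i)%:~R ^+ 2)); last by rewrite /Q {2}(cE x) CP.
    rewrite -real_normK ?num_real // -intr_norm natr_absz -rmorphXn /= ler_int.
    by rewrite -abszE expr2 -PoszM lez_nat; case: `|c x i|%N => // n; rewrite leq_pmulr.
  have sumQ : \sum_i `|c x i|%:R <= C * Q * d.+1%:R.
    apply: (@le_trans _ _ (\sum_(i < d) (C * Q))); first exact: ler_sum.
    by rewrite sumr_const card_ord -[_ *+ d]mulr_natr ler_wpM2l ?ler_nat // mulr_ge0 // ltW.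
  rewrite -mulr_suml mulrN lerN2 mulrA ler_pdivrMr ?mulr_gt0 //.
  rewrite (_ : _ * (C * _) = C * Q * d.+1%:R * eta); last by ring.
  by rewrite ler_wpM2r // ltW.
exists (((1 - q)^-1 *+ 2) ^+ d) => X.
apply: (le_trans (ler_sum _ (fun x _ => le_q x))).
pose g (y : {ffun 'I_d -> int}) := \prod_i q ^+ `|y i|%N.
have g0 y : 0 <= g y by rewrite prodr_ge0 // => i _; rewrite exprn_ge0 ?(andP q01).1.
have [X' ] := sum_fset_ffun_le [fset y in [seq c x | x <- X]]%fset g0.
rewrite -(big_map c predT g) => XX'; apply: le_trans.
  apply: (@le_trans _ _ _ _ _ _ XX'); apply: ler_sum_uniq => //.
    by rewrite map_inj_uniq ?fset_uniq.
  by move=> y; rewrite !inE.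
rewrite {1}/g; under eq_bigr => f _ do under eq_bigr => i _ do rewrite ffunE.
rewrite -(bigA_distr_bigA (fun i (z : X') => q ^+ `|val z|%N)) /=.
rewrite prodr_const card_ord; apply: lerXn2r; rewrite ?nnegrE.
- by rewrite sumr_ge0 // => z _; rewrite exprn_ge0 ?(andP q01).1.
- by rewrite mulrn_wge0 // invr_ge0 subr_ge0 ltW ?(andP q01).2.
- by have := sum_fset_int_geometric_le X' q01; rewrite big_seq_fsetE.
Qed.

End PositiveDefinite.
End EnergyLattice.

(** * Gibbs weights *)

Section GibbsSums.
Variables (R : realType) (L : zmodType) (r : nat) (F : L -> 'rV[int]_r).
Variables (lam : 'rV[R]_r).
Hypothesis F0 : F 0 = 0.
Hypothesis Q_ge0 : forall x, 0 <= Qform F lam x.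
Hypothesis sumQ : forall eta : R, 0 < eta -> exists S, forall X : {fset L},
  \sum_(x <- X) expR (- (eta * Qform F lam x)) <= S.

Lemma Qform0 mu : Qform F mu 0 = 0 :> R.
Proof. by rewrite /Qform big1 // => j _; rewrite F0 mxE mulr0. Qed.

(** This condition holds for [lam] and, eventually, for [lamN N]; it makes the bounds below uniform
    in the parameter. *)
Let half_dominated (mu : 'rV[R]_r) := forall x, Qform F lam x / 2 <= Qform F mu x.

Let lam_half : half_dominated lam.
Proof. by move=> x; have := Q_ge0 x; lra. Qed.

Let h x := expR (- (2^-1 * Qform F lam x)).

Let h_ge0 x : 0 <= h x. Proof. exact: expR_ge0. Qed.

Let h_bounded : exists S, forall X : {fset L}, \sum_(x <- X) h x <= S.
Proof. by apply: sumQ; rewrite invr_gt0. Qed.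

Let expR_le_h mu x : half_dominated mu -> 0 <= expR (- Qform F mu x) <= h x.
Proof. by move=> /(_ x) muQ; rewrite expR_ge0 ler_expR lerN2 mulrC. Qed.

Let partition_fin mu : half_dominated mu ->
  (\esum_(x in [set: L]) (expR (- Qform F mu x))%:E \is a fin_num)%E.
Proof.
move=> muQ; have [S SP] := h_bounded.
apply: (@esum_fin_num _ _ _ _ _ S) => [x|X _]; first exact: expR_ge0.
apply: le_trans (SP X); apply: ler_sum => x _.
by have /andP[] := expR_le_h x muQ.
Qed.

Let partition_ge mu (X : {fset L}) : half_dominated mu ->
  \sum_(x <- X) expR (- Qform F mu x) <= partition_function F mu.
Proof.
move=> muQ; rewrite -lee_fin /partition_function fineK ?partition_fin //.
by apply: fset_le_esum => // x; exact: expR_ge0.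
Qed.

Let partition_ge1 mu : half_dominated mu -> 1 <= partition_function F mu.
Proof.
move=> muQ; have := partition_ge [fset 0]%fset muQ.
by rewrite big_seq_fset1 Qform0 oppr0 expR0.
Qed.

Lemma partition_function_ge1 : 1 <= partition_function F lam.
Proof. exact: partition_ge1. Qed.

Lemma gibbs_ge0 x : 0 <= gibbs F lam x.
Proof.
by rewrite mulr_ge0 ?expR_ge0 // invr_ge0 (le_trans ler01) // partition_function_ge1.
Qed.

Lemma sum_gibbs_le1 (X : {fset L}) : \sum_(x <- X) gibbs F lam x <= 1.
Proof.
rewrite -mulr_sumr mulrC ler_pdivrMr ?mul1r ?partition_ge //.
exact: lt_le_trans partition_function_ge1.
Qed.

(** An error [eps] on the partition function only shrinks under normalization, as that function is
    at least 1. *)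
Lemma sum_gibbs_approx (eps : R) : 0 < eps -> exists X0 : {fset L},
  forall X : {fset L}, (X0 `<=` X)%fset -> 1 - eps <= \sum_(x <- X) gibbs F lam x.
Proof.
move=> eps0; have [X0 X0P] := esum_fset_approx h_ge0 h_bounded eps0.
exists X0 => X X0X; have := X0P _ _ X0X (fun x => expR_le_h x lam_half).
have Z1 := partition_function_ge1; have Z0 := lt_le_trans ltr01 Z1.
rewrite -/(partition_function F lam) ler_norml => /andP[_ ZX].
rewrite -mulr_sumr mulrC ler_pdivlMr //; nra.
Qed.

Variable C : R.
Hypothesis C_gt0 : 0 < C.
Hypothesis F_le_Q : forall x j, `|(F x 0 j)%:~R| <= C * Qform F lam x.

Let w x := (1 + 4%:R * C) * expR (- (4%:R^-1 * Qform F lam x)).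

Let w_ge0 x : 0 <= w x.
Proof. by rewrite mulr_ge0 ?expR_ge0 // addr_ge0 // mulr_ge0 // ltW. Qed.

Let w_bounded : exists S, forall X : {fset L}, \sum_(x <- X) w x <= S.
Proof.
have [S SP] := @sumQ 4%:R^-1 (ltac:(by rewrite invr_gt0)).
exists ((1 + 4%:R * C) * S) => X; rewrite -mulr_sumr ler_wpM2l //.
by rewrite addr_ge0 // mulr_ge0 // ltW.
Qed.

(** Half of the decay [exp(- q/2)] pays for the linear factor, since [1 + q/4 <= exp(q/4)] gives
    [C q exp(- q/4) <= 4 C]; the other half stays in [w]. *)
Let weight_le_w mu x : half_dominated mu ->
  (1 + C * Qform F lam x) * expR (- Qform F mu x) <= w x.
Proof.
move=> /(_ x) muQ; have q0 := Q_ge0 x; set q := Qform F lam x in muQ q0 *.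
apply: (@le_trans _ _ ((1 + C * q) * expR (- (q / 2)))).
  by rewrite ler_wpM2l ?ler_expR ?lerN2 // addr_ge0 // mulr_ge0 // ltW.
have -> : - (q / 2) = - (4%:R^-1 * q) + - (4%:R^-1 * q) by lra.
rewrite expRD mulrA /w -/q ler_wpM2r ?expR_ge0 //.
have e1 := expR_ge1Dx (4%:R^-1 * q).
have e0 : 0 < expR (4%:R^-1 * q) by exact: expR_gt0.
rewrite expRN ler_pdivrMr //; move: e1 e0; set E := expR _ => e1 e0.
have : 4%:R * C * (1 + 4%:R^-1 * q) <= 4%:R * C * E.
  by rewrite ler_wpM2l // mulr_ge0 // ltW.
have q4 : 0 <= 4%:R^-1 * q by rewrite mulr_ge0.
have -> : 4%:R * C * (1 + 4%:R^-1 * q) = 4%:R * C + C * q by field.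
have : 0 < 4%:R * C by rewrite mulr_gt0.
nra.
Qed.

Let gibbs_le_w mu x j : half_dominated mu -> `|gibbs F mu x * (F x 0 j)%:~R| <= w x.
Proof.
move=> muQ; apply: le_trans (weight_le_w x muQ).
have Z1 := partition_ge1 muQ; have Z0 := lt_le_trans ltr01 Z1.
rewrite /gibbs !normrM ger0_norm ?invr_ge0 ?(ltW Z0) //.
rewrite ger0_norm ?expR_ge0 //.
apply: (@le_trans _ _ (expR (- Qform F mu x) * `|(F x 0 j)%:~R|)).
  by rewrite -mulrA ler_piMl ?mulr_ge0 ?expR_ge0 ?invf_le1.
rewrite mulrC ler_wpM2r ?expR_ge0 //.
by apply: le_trans (F_le_Q x j) _; rewrite lerDr.
Qed.

Lemma mean_approx (eps : R) : 0 < eps -> exists X0 : {fset L},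
  forall X : {fset L}, (X0 `<=` X)%fset -> forall j,
  `|mean F lam 0 j - \sum_(x <- X) gibbs F lam x * (F x 0 j)%:~R| <= eps.
Proof.
move=> eps0; have [X0 X0P] := expectation_fset_approx w_ge0 w_bounded eps0.
exists X0 => X X0X j; rewrite mxE; apply: X0P => // x.
exact: gibbs_le_w.
Qed.

(** * Continuity of the mean along a convergent sequence of parameters *)

Section Convergence.
Variable lamN : nat -> 'rV[R]_r.
Hypothesis lamN_cvg : lamN N @[N --> \oo] --> lam.

Let coord_cvg j : lamN N 0 j @[N --> \oo] --> lam 0 j.
Proof. exact: (cvg_comp _ _ lamN_cvg (@coord_continuous _ _ _ 0 j lam)). Qed.

Let Qform_cvg x : Qform F (lamN N) x @[N --> \oo] --> Qform F lam x.
Proof.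
apply: (cvg_big (op := +%R)); first exact: add_continuous.
by move=> j _; apply: cvgMr_tmp; exact: coord_cvg.
Qed.

(** The two forms differ at [x] by at most the l1 distance of the parameters times
    [C * Qform F lam x], which is half of the form once that distance is below [1/(2C)]. *)
Let lamN_half : \forall N \near \oo, half_dominated (lamN N).
Proof.
have s_cvg : \sum_j `|lam 0 j - lamN N 0 j| @[N --> \oo] --> (0 : R).
  rewrite [X in _ --> X](_ : _ = \sum_(j < r) 0); last by rewrite big1.
  apply: (cvg_big (op := +%R)); first exact: add_continuous.
  move=> j _; rewrite -[X in _ --> X](normr0 R) -(subrr (lam 0 j)).
  by apply: cvg_norm; apply: cvgB; [exact: cvg_cst | exact: coord_cvg].
have e0 : 0 < (2 * C)^-1 by rewrite invr_gt0 mulr_gt0.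
have /cvgrPdist_le/(_ _ e0) := s_cvg; apply: filterS => N.
rewrite sub0r normrN ger0_norm ?sumr_ge0 // => sN x.
have : Qform F lam x - Qform F (lamN N) x <= (2 * C)^-1 * (C * Qform F lam x).
  rewrite /Qform -sumrB; apply: (@le_trans _ _
      (\sum_j `|lam 0 j - lamN N 0 j| * (C * Qform F lam x))).
    apply: ler_sum => j _; rewrite -mulrBl; apply: le_trans (ler_norm _) _.
    by rewrite normrM ler_wpM2l.
  by rewrite -mulr_suml ler_wpM2r // mulr_ge0 // ltW.
have -> : (2 * C)^-1 * (C * Qform F lam x) = Qform F lam x / 2.
  by field; rewrite gt_eqF.
lra.
Qed.

Let partition_cvg :
  partition_function F (lamN N) @[N --> \oo] --> partition_function F lam.
Proof.
apply: (@cvg_of_fset_approx _ _ _ _ (fun N x => expR (- Qform F (lamN N) x))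
  (fun x => expR (- Qform F lam x))) => [eps eps0|x].
  have [X0 X0P] := esum_fset_approx h_ge0 h_bounded eps0.
  exists X0; split; last by apply: X0P => // x; exact: expR_le_h.
  by apply: filterS lamN_half => N muQ; apply: X0P => // x; exact: expR_le_h.
apply: continuous_cvg; first exact: continuous_expR.
by apply: cvgN; exact: Qform_cvg.
Qed.

Lemma mean_cvg j : mean F (lamN N) 0 j @[N --> \oo] --> mean F lam 0 j.
Proof.
apply: (@cvg_of_fset_approx _ _ _ _ (fun N x => gibbs F (lamN N) x * (F x 0 j)%:~R)
  (fun x => gibbs F lam x * (F x 0 j)%:~R)) => [eps eps0|x].
  have [X0 X0P] := expectation_fset_approx w_ge0 w_bounded eps0.
  exists X0; split; last by rewrite mxE; apply: X0P => // x; exact: gibbs_le_w.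
  apply: filterS lamN_half => N muQ; rewrite mxE.
  by apply: X0P => // x; exact: gibbs_le_w.
apply: cvgMr_tmp; apply: cvgM.
  apply: cvgV partition_cvg.
  by rewrite gt_eqF // (lt_le_trans ltr01) // partition_function_ge1.
apply: continuous_cvg; first exact: continuous_expR.
by apply: cvgN; exact: Qform_cvg.
Qed.

End Convergence.
End GibbsSums.

(** * Lower bound for the mass of the shell *)

(** List each [x] with multiplicity [n x] and pad with 0 up to length [K]; the padding is free
    because [F 0 = 0]. *)
Lemma sum_nth_nseq (L M : zmodType) (F : L -> M) (X : seq L) (n : L -> nat) K :
    F 0 = 0 -> (\sum_(x <- X) n x <= K)%N ->
  exists y : {ffun 'I_K -> L}, \sum_i F (y i) = \sum_(x <- X) F x *+ n x.
Proof.
move=> F0 nK; pose s := flatten [seq nseq (n x) x | x <- X].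
have size_s : size s = (\sum_(x <- X) n x)%N.
  rewrite size_flatten /shape -map_comp sumnE big_map.
  by apply: eq_bigr => x _ /=; rewrite size_nseq.
pose s' := s ++ nseq (K - size s) 0.
have size_s' : size s' = K by rewrite size_cat size_nseq subnKC // size_s.
exists [ffun i : 'I_K => nth 0 s' i].
under eq_bigr => i _ do rewrite ffunE.
rewrite -(big_mkord predT (fun i => F (nth 0 s' i))) -[in index_iota _ _]size_s'.
rewrite -(big_nth 0 predT) big_cat /= big_nseq F0.
rewrite (_ : iter _ _ _ = 0) ?addr0; last by elim: (_ - _)%N => //= k ->; rewrite addr0.
rewrite big_flatten big_map; apply: eq_bigr => x _.
by rewrite big_nseq iter_addr addr0.
Qed.

(** Extending the coefficients by 0 lets the same [b] work over every larger [X], so combinations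
    for different vectors can be put on a common support. *)
Lemma generated_subgroup_sum (L M : zmodType) (F : L -> M) (v : M) :
  F 0 = 0 -> generated_subgroup (range F) v ->
  exists (X1 : {fset L}) (b : L -> int), (forall x, x \notin X1 -> b x = 0) /\
    forall X : {fset L}, (X1 `<=` X)%fset -> v = \sum_(x <- X) F x *~ b x.
Proof.
move=> F0 vgen.
have [s ->] : exists s : seq (L * int), v = \sum_(u <- s) F u.1 *~ u.2.
  (* By minimality it suffices that the finite integer combinations form a subgroup containing the
     range. *)
  apply: (vgen [set v | exists s : seq (L * int), v = \sum_(u <- s) F u.1 *~ u.2]).
  split=> [|_ [x _ <-] /=]; last by exists [:: (x, 1)]; rewrite big_seq1.
  split=> [|_ _ [s1 ->] [s2 ->]]; first by exists [::]; rewrite big_nil.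
  exists (s1 ++ [seq (u.1, - u.2) | u <- s2]).
  rewrite big_cat big_map /= -sumrN; congr (_ + _).
  by apply: eq_bigr => u _; rewrite mulrNz.
exists [fset u.1 | u in s]%fset, (fun x => \sum_(u <- s | u.1 == x) u.2); split.
  move=> x xs; rewrite big_seq_cond big1 // => u /andP[us /eqP ux].
  by case/negP: xs; rewrite -ux; apply/imfsetP; exists u.
move=> X sX; transitivity (\sum_(x <- X) \sum_(u <- s | u.1 == x) F u.1 *~ u.2).
  rewrite (exchange_big_dep predT) //= big_seq [RHS]big_seq.
  apply: eq_bigr => u us; have uX : u.1 \in X.
    by apply: (fsubsetP sX); apply/imfsetP; exists u.
  rewrite big_mkcond (big_fsetD1 _ uX) /= eqxx big_seq big1 ?addr0 // => x.
  by rewrite in_fsetD1 eq_sym => /andP[/negbTE ->].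
apply: eq_bigr => x _; rewrite mulrz_sumr.
by apply: eq_bigr => u /eqP ->.
Qed.

Lemma seq_pos_lower_bound (R : realDomainType) (T : eqType) (p : T -> R) (X : seq T) :
  (forall x, 0 < p x) -> exists2 delta, 0 < delta & {in X, forall x, delta <= p x}.
Proof.
move=> p0; elim: X => [|x X [delta delta0 deltaP]]; first by exists 1.
exists (Num.min (p x) delta) => [|y]; first by rewrite lt_min p0.
rewrite inE ge_min => /predU1P[->|yX]; first by rewrite lexx.
by rewrite deltaP ?orbT.
Qed.

Section Realization.
Variables (R : realType) (L : zmodType) (r : nat) (F : L -> 'rV[int]_r).
Variables (p : L -> R) (m : 'I_r -> R).
Hypothesis F0 : F 0 = 0.
Hypothesis F_gen : generated_subgroup (range F) = [set: 'rV[int]_r].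
Hypothesis p_gt0 : forall x, 0 < p x.
Hypothesis sum_p_le1 : forall X : {fset L}, \sum_(x <- X) p x <= 1.
Hypothesis m_approx : forall eps : R, 0 < eps -> exists X0 : {fset L},
  forall X : {fset L}, (X0 `<=` X)%fset -> forall j,
  `|m j - \sum_(x <- X) p x * (F x 0 j)%:~R| <= eps.

(* Start from the multiplicities [trunc (K * p x)], whose sum is close to [K m];
   the integral combination correcting the error has coefficients small compared
   to [K], and the slack left by [p 0] absorbs the extra copies. *)
Lemma sums_near_mean : exists2 c : R, 0 < c & exists K0, forall K (v : 'rV[int]_r),
  (K0 <= K)%N -> (forall j, `|(v 0 j)%:~R - K%:R * m j| <= c * K%:R) ->
  exists y : {ffun 'I_K -> L}, \sum_i F (y i) = v.
Proof.
have /boolp.choice[X1 /boolp.choice[b bP]] : forall j : 'I_r,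
    exists (X1 : {fset L}) (b : L -> int), (forall x, x \notin X1 -> b x = 0) /\
    forall X : {fset L}, (X1 `<=` X)%fset -> 'e_j = \sum_(x <- X) F x *~ b x.
  by move=> j; apply: generated_subgroup_sum => //; rewrite F_gen.
(* The point 0 is included so that [delta] also bounds [p 0] from below. *)
pose X2 := [fset x in 0 :: flatten [seq enum_fset (X1 j) | j <- enum 'I_r]]%fset.
have X12 j : (X1 j `<=` X2)%fset.
  apply/fsubsetP => x xj; rewrite !inE; apply/orP; right; apply/flattenP.
  by exists (enum_fset (X1 j)) => //; by apply: map_f; rewrite mem_enum.
have zX2 : 0 \in X2 by rewrite !inE eqxx.
have [delta delta0 deltaP] := seq_pos_lower_bound X2 p_gt0.
pose g x : R := \sum_j `|(b j x)%:~R|.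
have g0 x : 0 <= g x by rewrite sumr_ge0.
pose D : R := 1 + \sum_(x <- X2) g x.
have D0 : 0 < D.
  by rewrite ltr_pwDl // sumr_ge0.
(* Corrections will have size at most [3 c K D = delta K / 2], half of the guaranteed multiplicity
   [delta K]. *)
pose c := delta / (6%:R * D); have c0 : 0 < c by rewrite divr_gt0 // mulr_gt0.
have [X0 X0P] := m_approx c0.
pose X := (X0 `|` X2)%fset; pose Y := (X `\ 0)%fset.
pose A : R := \sum_j \sum_(x <- Y) `|(F x 0 j)%:~R|.
(* The threshold gives [A <= c K], which absorbs the rounding errors, and [delta K >= 2], so that
   [delta K - 1 >= delta K / 2]. *)
exists c => //; exists (Num.trunc (A / c + 2 / delta)).+1 => K v KK0 vK.
have gX2 x : x \notin X2 -> g x = 0.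
  move=> xX2; rewrite /g big1 // => j _; rewrite (bP j).1 ?normr0 //.
  by apply: contra xX2; apply: fsubsetP.
have gD x : g x <= D.
  have [xX2|/gX2 ->] := boolP (x \in X2); last exact: ltW.
  by rewrite /D (big_fsetD1 x) //= addrCA lerDl addr_ge0 // sumr_ge0.
have sum_gX : \sum_(x <- X) g x <= D.
  rewrite (bigID [in X2]) /= [X in _ + X]big1 ?addr0 => [|x /gX2 //].
  rewrite -big_filter; apply: (@le_trans _ _ (\sum_(x <- X2) g x)); last by rewrite lerDr.
  apply: ler_sum_uniq => //; first by rewrite filter_uniq ?fset_uniq.
  by move=> x; rewrite mem_filter => /andP[].
have zX : 0 \in X by rewrite in_fsetU zX2 orbT.
have sumY (f : L -> 'rV[int]_r) : f 0 = 0 -> \sum_(x <- X) f x = \sum_(x <- Y) f x.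
  by move=> f0; rewrite (big_fsetD1 0) //= f0 add0r.
have A0 : 0 <= A by rewrite sumr_ge0 // => j _; rewrite sumr_ge0.
have Ac0 : 0 <= A / c by rewrite divr_ge0 // ltW.
have d20 : 0 <= 2 / delta by rewrite divr_ge0 // ltW.
have K0 : A / c + 2 / delta < K%:R :> R.
  by rewrite -truncn_lt_nat // addr_ge0.
have cD : c * D = delta / 6%:R by rewrite /c; field; rewrite gt_eqF.
have KA : A <= c * K%:R.
  rewrite mulrC -ler_pdivrMr //; apply: ltW; apply: le_lt_trans K0.
  by rewrite lerDl.
have Kdelta : 2 <= delta * K%:R.
  rewrite mulrC -ler_pdivrMr //; apply: ltW; apply: le_lt_trans K0.
  by rewrite lerDr.
pose t x := Num.trunc (K%:R * p x).
have Kp0 x : 0 <= K%:R * p x by rewrite mulr_ge0 // ltW.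
have t_le x : (t x)%:R <= K%:R * p x by rewrite -truncn_ge_nat.
have t_ge x : K%:R * p x - 1 <= (t x)%:R.
  rewrite lerBlDr natr1; apply: ltW.
  by rewrite -truncn_lt_nat.
pose u := v - \sum_(x <- Y) F x *+ t x.
(* Three errors of size [c K]: the deviation of [v], the restriction of the mean to [X], and the
   rounding of the multiplicities. *)
have uj j : `|(u 0 j)%:~R| <= 3%:R * c * K%:R.
  have -> : (u 0 j)%:~R = ((v 0 j)%:~R - K%:R * m j)
      + K%:R * (m j - \sum_(x <- X) p x * (F x 0 j)%:~R)
      + \sum_(x <- Y) (K%:R * p x - (t x)%:R) * (F x 0 j)%:~R :> R.
    have -> : \sum_(x <- X) p x * (F x 0 j)%:~R = \sum_(x <- Y) p x * (F x 0 j)%:~R.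
      by rewrite (big_fsetD1 0) //= F0 mxE mulr0 add0r.
    have -> : (u 0 j)%:~R = (v 0 j)%:~R - \sum_(x <- Y) (t x)%:R * (F x 0 j)%:~R :> R.
      rewrite /u !mxE rmorphB /= summxE raddf_sum /=; congr (_ - _).
      by apply: eq_bigr => x _; rewrite mulmxnE raddfMn /= mulr_natl.
    have -> : \sum_(x <- Y) (K%:R * p x - (t x)%:R) * (F x 0 j)%:~R =
        K%:R * \sum_(x <- Y) p x * (F x 0 j)%:~R
        - \sum_(x <- Y) (t x)%:R * (F x 0 j)%:~R :> R.
      rewrite mulr_sumr -sumrB; apply: eq_bigr => x _.
      by rewrite mulrBl -mulrA.
    by ring.
  apply: le_trans (ler_normD _ _) _; apply: (@le_trans _ _ (2 * c * K%:R + A)); last by lra.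
  apply: lerD.
    apply: le_trans (ler_normD _ _) _; have := vK j.
    have : `|K%:R * (m j - \sum_(x <- X) p x * (F x 0 j)%:~R)| <= c * K%:R.
      by rewrite normrM normr_nat mulrC ler_wpM2r // X0P // fsubsetUl.
    lra.
  apply: le_trans (ler_norm_sum _ _ _) _; rewrite /A (bigD1 j) //= -[leLHS]addr0.
  apply: lerD; last by rewrite sumr_ge0 // => k _; rewrite sumr_ge0.
  apply: ler_sum => x _; rewrite normrM ler_piMl //.
  by rewrite ler_norml; have := t_le x; have := t_ge x; lra.
pose b' x := \sum_j u 0 j * b j x.
have b'_le x : `|(b' x)%:~R| <= 3%:R * c * K%:R * g x.
  rewrite raddf_sum /= mulr_sumr; apply: le_trans (ler_norm_sum _ _ _) _.
  by apply: ler_sum => j _; rewrite intrM normrM ler_wpM2r ?uj.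
have uE : u = \sum_(x <- Y) F x *~ b' x.
  rewrite -(sumY (fun x => F x *~ b' x)); last by rewrite F0 mul0rz.
  rewrite [LHS]row_sum_delta.
  transitivity (\sum_j \sum_(x <- X) F x *~ b j x *~ u 0 j).
    apply: eq_bigr => j _; rewrite ((bP j).2 X); last first.
      by apply: fsubset_trans (X12 j) (fsubsetUr _ _).
    by rewrite -mulrz_suml -[u 0 j in LHS]intz scaler_int.
  rewrite exchange_big /=; apply: eq_bigr => x _; rewrite mulrz_sumr.
  by apply: eq_bigr => j _; rewrite mulrzA_C.
(* Off [X2] the correction vanishes; on [X2] it is at most [delta K / 2], while
   [t x >= delta K - 1]. *)
have pos x : 0 <= (t x)%:Z + b' x.
  rewrite -(ler_int R) rmorphD /=.
  have [xX2|xX2] := boolP (x \in X2); last first.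
    suff -> : (b' x)%:~R = 0 :> R by rewrite addr0.
    by apply/eqP; rewrite -normr_le0; apply: le_trans (b'_le x) _; rewrite gX2 ?mulr0.
  have := b'_le x; have := t_ge x; have := gD x; have := deltaP _ xX2.
  have : 0 <= K%:R :> R by []; have := ler_norm (- (b' x)%:~R : R); rewrite normrN.
  have := g0 x.
  move: cD Kdelta c0; set k : R := K%:R; set B : R := `|_|; set bb : R := (b' x)%:~R.
  rewrite -[(t x)%:~R]/((t x)%:R).
  set tt : R := (t x)%:R.
  move=> cD Kdelta c0 gx0 bB k0 dp gxD tk Bg.
  have : c * k * g x <= c * k * D by rewrite ler_wpM2l // mulr_ge0 // ltW.
  have -> : c * k * D = k * (c * D) by ring.
  have : k * delta <= k * p x by rewrite ler_wpM2l.
  rewrite cD; nra.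
(* The number of copies is at most [K (1 - p 0) + delta K / 2], which is below [K] since
   [delta <= p 0]. *)
have [|y yE] := sum_nth_nseq (X := Y) (n := fun x => `|((t x)%:Z + b' x)%R|%N) (K := K) F0.
  rewrite -(ler_nat R) natr_sum.
  apply: (@le_trans _ _ (\sum_(x <- Y) (K%:R * p x + 3%:R * c * K%:R * g x))).
    apply: ler_sum => x _; rewrite natr_absz ger0_norm // rmorphD /=.
    by apply: lerD (t_le x) _; apply: le_trans (ler_norm _) (b'_le x).
  rewrite big_split /= -!mulr_sumr.
  have pY : \sum_(x <- Y) p x <= 1 - p 0.
    by have := sum_p_le1 X; rewrite (big_fsetD1 0) //=; lra.
  have gY : \sum_(x <- Y) g x <= D.
    by apply: le_trans sum_gX; rewrite (big_fsetD1 0 zX) /= lerDr.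
  have k0 : 0 <= K%:R :> R by [].
  have := ler_wpM2l k0 pY; have := ler_wpM2l (mulr_ge0 (ltW c0) k0) gY.
  have -> : c * K%:R * D = K%:R * (c * D) by ring.
  have := ler_wpM2l k0 (deltaP _ zX2).
  rewrite cD; nra.
exists y; rewrite yE -[RHS](subrK (\sum_(x <- Y) F x *+ t x)) -/u uE -big_split /=.
apply: eq_bigr => x _; rewrite addrC -[F x *+ t x]/(F x *~ (t x)%:Z) -mulrzDr.
by rewrite -[LHS]/(F x *~ `|((t x)%:Z + b' x)%R|%N) gez0_abs.
Qed.

End Realization.

(** * Completing configurations by additional coordinates *)

Section Concatenation.
Variables (L : Type) (M K : nat).

Definition ffun_cat (x : {ffun 'I_M -> L}) (z : {ffun 'I_K -> L}) :
    {ffun 'I_(M + K) -> L} :=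
  [ffun i => match fintype.split i with inl a => x a | inr b => z b end].

Lemma ffun_cat_lshift x z (i : 'I_M) : ffun_cat x z (lshift K i) = x i.
Proof. by rewrite ffunE -[lshift _ _]/(unsplit (inl i)) unsplitK. Qed.

Lemma ffun_cat_rshift x z (i : 'I_K) : ffun_cat x z (rshift M i) = z i.
Proof. by rewrite ffunE -[rshift _ _]/(unsplit (inr i)) unsplitK. Qed.

Lemma big_ffun_cat (A : Type) (idx : A) (op : Monoid.law idx) (f : L -> A) x z :
  \big[op/idx]_i f (ffun_cat x z i) =
  op (\big[op/idx]_i f (x i)) (\big[op/idx]_i f (z i)).
Proof.
rewrite big_split_ord; congr (op _ _); apply: eq_bigr => i _.
  by rewrite ffun_cat_lshift.
by rewrite ffun_cat_rshift.
Qed.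

End Concatenation.

(** The first [M] coordinates recover [x], so distinct [x] have distinct completions and the masses
    add up. *)
Lemma complete_configurations (R : numDomainType) (L A : zmodType)
    (F : L -> A) (p : L -> R) (X : {fset L}) N M K (P : pred {ffun 'I_M -> X})
    (v : A) (kappa : R) : N = (M + K)%N -> (forall x, 0 <= p x) ->
    (forall x, P x -> exists2 z : {ffun 'I_K -> L},
      \sum_i F (val (x i)) + \sum_i F (z i) = v & kappa <= \prod_i p (z i)) ->
  exists2 Y : {fset {ffun 'I_N -> L}},
    (forall y, y \in Y -> \sum_i F (y i) = v) &
    kappa * \sum_(x | P x) \prod_i p (val (x i)) <= \sum_(y <- Y) \prod_i p (y i).
Proof.
move=> -> p0 Pz.
have /boolp.choice[z zP] : forall x, exists z : {ffun 'I_K -> L}, P x ->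
    \sum_i F (val (x i)) + \sum_i F (z i) = v /\ kappa <= \prod_i p (z i).
  move=> x; have [Px|_] := boolP (P x); last by exists [ffun=> 0].
  by have [z] := Pz _ Px; exists z.
pose h (x : {ffun 'I_M -> X}) := ffun_cat [ffun i => val (x i)] (z x).
have h_inj : injective h.
  move=> x x' /ffunP hx; apply/ffunP => i; apply: val_inj.
  by have := hx (lshift K i); rewrite !ffun_cat_lshift !ffunE.
have big_h (T : Type) (idx : T) (op : Monoid.law idx) (f : L -> T) x :
    \big[op/idx]_i f (h x i) =
    op (\big[op/idx]_i f (val (x i))) (\big[op/idx]_i f (z x i)).
  by rewrite big_ffun_cat; congr (op _ _); apply: eq_bigr => i _; rewrite ffunE.
exists [fset y in [seq h x | x <- enum P]]%fset.
  move=> y; rewrite !inE => /mapP[x]; rewrite mem_enum => Px ->.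
  by rewrite big_h /= (zP _ Px).1.
apply: (@le_trans _ _ (\sum_(y <- [seq h x | x <- enum P]) \prod_i p (y i))).
  rewrite big_map big_enum mulr_sumr; apply: ler_sum => x Px.
  by rewrite big_h /= mulrC ler_wpM2l ?prodr_ge0 // (zP _ Px).2.
apply: ler_sum_uniq => [y||y]; first exact: prodr_ge0.
  by rewrite map_inj_uniq ?enum_uniq.
by rewrite !inE.
Qed.

(** Combine [exp(u) (1 - u) <= 1] with [(1 + u + 2 u^2)(1 - u) = 1 + u^2 (1 - 2 u) >= 1]. *)
Lemma expR_le_quadratic (R : realType) (u : R) : u <= 2^-1 ->
  expR u <= 1 + u + 2 * u ^+ 2.
Proof.
move=> u2; have := expR_ge1Dx (- u); rewrite expRN.
have : 0 < expR u by exact: expR_gt0.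
set E := expR u => E0.
rewrite -(ler_pM2l E0) mulfV ?gt_eqF // => EU.
have : 0 < 1 - u by lra.
have := sqr_ge0 u; nra.
Qed.

(** Chernoff bound for a weight of arbitrary positive mass: the exponential moment of [g - tau] is
    at most [exp(- a)] times the mass, with [a = theta * tau / 2]. *)
Lemma upper_tail_le (R : realType) (T : finType) (p g : T -> R) (tau : R) :
    (forall t, 0 <= p t) -> 0 < \sum_t p t -> 0 < tau ->
    \sum_t p t * g t <= tau / 4%:R * \sum_t p t ->
  forall delta, 0 < delta -> exists M0, forall M, (M0 <= M)%N ->
    \sum_(x : {ffun 'I_M -> T} | tau * M%:R < \sum_i g (x i)) \prod_i p (x i)
    <= delta * (\sum_t p t) ^+ M.
Proof.
move=> p0; set s := \sum_t p t => s0 tau0 pg delta delta0.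
pose B : R := 1 + \sum_t `|g t|.
have B1 : 1 <= B by rewrite lerDl sumr_ge0.
have gB t : `|g t| <= B by rewrite /B (bigD1 t) //= addrCA lerDl addr_ge0 // sumr_ge0.
have B0 : 0 < B := lt_le_trans ltr01 B1.
(* Small enough that [theta * B <= 1/2], where the quadratic bound applies, and that the quadratic
   term is at most [theta * tau / 4]. *)
pose theta := (2 * B + 8%:R * B ^+ 2 / tau)^-1.
have theta0 : 0 < theta by rewrite invr_gt0 addr_gt0 ?divr_gt0 ?mulr_gt0 ?exprn_gt0.
have thetaB : theta * (2 * B + 8%:R * B ^+ 2 / tau) = 1.
  by rewrite mulVf // gt_eqF // -invr_gt0.
have Btau : 0 < 8%:R * B ^+ 2 / tau by rewrite divr_gt0 ?mulr_gt0 ?exprn_gt0.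
have thetaB1 : theta * B <= 2^-1 by nra.
have thetaB2 : 2 * theta * B ^+ 2 <= tau / 4%:R.
  have : theta * (8%:R * B ^+ 2 / tau) <= 1 by nra.
  by rewrite !mulrA ler_pdivrMr // mul1r; lra.
pose a := theta * tau / 2; have a0 : 0 < a by rewrite divr_gt0 ?mulr_gt0.
have step : \sum_t p t * expR (theta * (g t - tau)) <= s * expR (- a).
  apply: (@le_trans _ _ (expR (- (theta * tau)) *
      \sum_t p t * (1 + theta * g t + 2 * theta ^+ 2 * B ^+ 2))).
    rewrite mulr_sumr; apply: ler_sum => t _.
    rewrite mulrBr addrC expRD mulrCA ler_wpM2l ?expR_ge0 // ler_wpM2l //.
    have gt1 := ler_norm (g t); have gt2 := ler_norm (- g t); rewrite normrN in gt2.
    have gt := gB t.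
    have u2 : theta * g t <= 2^-1 by nra.
    apply: le_trans (expR_le_quadratic u2) _; rewrite lerD2l exprMn -mulrA.
    rewrite ler_wpM2l // ler_wpM2l ?sqr_ge0 //.
    by rewrite -[g t ^+ 2]real_normK ?num_real // lerXn2r ?nnegrE // ltW.
  have -> : \sum_t p t * (1 + theta * g t + 2 * theta ^+ 2 * B ^+ 2) =
      s * (1 + 2 * theta ^+ 2 * B ^+ 2) + theta * \sum_t p t * g t.
    rewrite mulr_suml mulr_sumr -big_split; apply: eq_bigr => t _ /=; ring.
  apply: (@le_trans _ _ (expR (- (theta * tau)) * (s * expR (theta * tau / 2)))).
    rewrite ler_wpM2l ?expR_ge0 //.
    apply: (@le_trans _ _ (s * (1 + theta * tau / 2))); last first.
      by rewrite ler_wpM2l ?expR_ge1Dx // ltW.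
    have := ler_wpM2l (ltW theta0) pg.
    have := ler_wpM2l (ltW (mulr_gt0 s0 theta0)) thetaB2.
    lra.
  rewrite mulrCA -expRD /a ler_wpM2l ?ler_expR ?(ltW s0) //; lra.
(* From here on [exp(a M) >= 1 + a M >= 1/delta]. *)
exists (Num.trunc (a * delta)^-1).+1 => M M0M.
apply: (@le_trans _ _ ((s * expR (- a)) ^+ M)); last first.
  rewrite exprMn mulrC ler_wpM2r ?exprn_ge0 ?(ltW s0) // -expRM_natl mulrN.
  rewrite expRN invf_ple ?posrE ?expR_gt0 //; apply: le_trans (expR_ge1Dx _).
  have aM : (a * delta)^-1 <= M%:R.
    by apply: ltW; rewrite -truncn_lt_nat // invr_ge0 ltW ?mulr_gt0.
  rewrite -(ler_pM2l a0) invfM mulVKf ?gt_eqF // in aM.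
  lra.
apply: (@le_trans _ _ (\sum_(x : {ffun 'I_M -> T})
    \prod_i (p (x i) * expR (theta * (g (x i) - tau))))); last first.
  rewrite -(bigA_distr_bigA (fun _ t => p t * expR (theta * (g t - tau)))) /=.
  rewrite prodr_const card_ord; apply: lerXn2r; rewrite ?nnegrE //.
    by rewrite sumr_ge0 // => t _; rewrite mulr_ge0 ?expR_ge0.
  by rewrite mulr_ge0 ?expR_ge0 // ltW.
rewrite [leRHS](bigID (fun x : {ffun 'I_M -> T} => tau * M%:R < \sum_i g (x i))) /=.
rewrite -[leLHS]addr0 lerD //; last first.
  by rewrite sumr_ge0 // => x _; rewrite prodr_ge0 // => i _; rewrite mulr_ge0 ?expR_ge0.
apply: ler_sum => x xM; rewrite big_split /= ler_peMr ?prodr_ge0 //.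
rewrite -expR_sum -expR0 ler_expR -mulr_sumr mulr_ge0 ?(ltW theta0) //.
by rewrite sumrB sumr_const card_ord -mulr_natr subr_ge0 ltW.
Qed.

Section LowerBound.
Variables (R : realType) (L : zmodType) (r : nat) (F : L -> 'rV[int]_r).
Variables (p : L -> R) (m : 'I_r -> R) (lam : 'rV[R]_r) (zeta : R).
Hypothesis F0 : F 0 = 0.
Hypothesis F_gen : generated_subgroup (range F) = [set: 'rV[int]_r].
Hypothesis zeta_ge0 : 0 <= zeta.
Hypothesis pE : forall x, p x = expR (- zeta - Qform F lam x).
Hypothesis sum_p_le1 : forall X : {fset L}, \sum_(x <- X) p x <= 1.
Hypothesis sum_p_approx : forall eps : R, 0 < eps -> exists X0 : {fset L},
  forall X : {fset L}, (X0 `<=` X)%fset -> 1 - eps <= \sum_(x <- X) p x.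
Hypothesis m_approx : forall eps : R, 0 < eps -> exists X0 : {fset L},
  forall X : {fset L}, (X0 `<=` X)%fset -> forall j,
  `|m j - \sum_(x <- X) p x * (F x 0 j)%:~R| <= eps.

Let p_gt0 x : 0 < p x. Proof. by rewrite pE expR_gt0. Qed.
Let p_ge0 x : 0 <= p x. Proof. exact: ltW. Qed.

(** The weight sees a configuration only through its sum of [F], hence is constant on a shell. *)
Lemma prod_gibbs (I : finType) (z : {ffun I -> L}) :
  \prod_i p (z i) =
  expR (- (#|I|%:R * zeta) - \sum_j lam 0 j * ((\sum_i F (z i)) 0 j)%:~R).
Proof.
under eq_bigr do rewrite pE; rewrite -expR_sum; congr expR.
rewrite sumrB sumr_const cardT -cardE mulr_natl mulNrn; congr (_ - _).
rewrite exchange_big /=; apply: eq_bigr => j _.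
by rewrite -mulr_sumr summxE raddf_sum.
Qed.

Lemma typical_mass_ge (tau : R) : 0 < tau -> forall rho, rho < 1 ->
  exists (X : {fset L}) M0, rho <= \sum_(x <- X) p x /\
  forall M, (M0 <= M)%N ->
    (\sum_(x <- X) p x) ^+ M / 2 <=
    \sum_(x : {ffun 'I_M -> X} |
       [forall j, `|\sum_i (F (val (x i)) 0 j)%:~R - M%:R * m j| <= tau * M%:R])
      \prod_i p (val (x i)).
Proof.
move=> tau0 rho rho1.
pose S := 1 + \sum_j `|m j|; have S0 : 0 < S by rewrite ltr_pwDl // sumr_ge0.
have mS j : `|m j| <= S by rewrite /S (bigD1 j) //= addrCA lerDl addr_ge0 // sumr_ge0.
(* The three entries give mass at least [1/2], mass at least [rho], and a drift [eps * S <= tau/16]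
   caused by the missing mass. *)
pose eps := Num.min 2^-1 (Num.min (1 - rho) (tau / (16%:R * S))).
have eps0 : 0 < eps.
  by rewrite !lt_min subr_gt0 rho1 invr_gt0 divr_gt0 ?mulr_gt0 ?ltr0n.
have [X1 X1P] := sum_p_approx eps0.
have [X2 X2P] : exists X0 : {fset L}, _ := m_approx (ltac:(exact: divr_gt0 tau0 (ltr0Sn R 15))).
pose X := (X1 `|` X2)%fset; exists X; set s := \sum_(x <- X) p x.
have s_ge : 1 - eps <= s by apply: X1P; apply: fsubsetUl.
have mX j : `|m j - \sum_(x <- X) p x * (F x 0 j)%:~R| <= tau / 16%:R.
  by apply: X2P; apply: fsubsetUr.
have s_le : s <= 1 by exact: sum_p_le1.
have [e1 e2 e3] : [/\ eps <= 2^-1, eps <= 1 - rho & eps * (16%:R * S) <= tau].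
  split; first by rewrite ge_min lexx.
    by rewrite !ge_min lexx orbT.
  by rewrite -ler_pdivlMr ?mulr_gt0 // !ge_min lexx !orbT.
have s0 : 0 < s by lra.
have sE : s = \sum_(x : X) p (val x) by rewrite /s big_seq_fsetE.
have mean_j j : `|\sum_(x : X) p (val x) * ((F (val x) 0 j)%:~R - m j)| <= tau / 4%:R * s.
  have -> : \sum_(x : X) p (val x) * ((F (val x) 0 j)%:~R - m j) =
      (1 - s) * m j - (m j - \sum_(x <- X) p x * (F x 0 j)%:~R).
    rewrite big_seq_fsetE sE mulrBl mul1r mulr_suml /=.
    under eq_bigr do rewrite mulrBr.
    rewrite sumrB; ring.
  apply: le_trans (ler_normB _ _) _.
  have : `|(1 - s) * m j| <= eps * S.
    by rewrite normrM ger0_norm ?subr_ge0 // ler_pM ?subr_ge0 //; lra.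
  have := mX j; nra.
(* A union bound over the [2 r] pairs of a coordinate and a sign leaves at most half of the total
   mass for the atypical configurations. *)
pose delta : R := (4%:R * r.+1%:R)^-1.
have delta0 : 0 < delta by rewrite invr_gt0 mulr_gt0.
pose g (u : 'I_r * bool) (x : X) : R := (-1) ^+ u.2 * ((F (val x) 0 u.1)%:~R - m u.1).
have /boolp.choice[M0 M0P] : forall u, exists M0, forall M, (M0 <= M)%N ->
    \sum_(x : {ffun 'I_M -> X} | tau * M%:R < \sum_i g u (x i))
      \prod_i p (val (x i)) <= delta * s ^+ M.
  move=> [j b]; rewrite sE.
  apply: (@upper_tail_le _ _ (fun x : X => p (val x)) (g (j, b))) => //.
    by rewrite -sE.
  rewrite -sE /g /=; under eq_bigr do rewrite mulrCA.
  rewrite -mulr_sumr; apply: le_trans (mean_j j); apply: le_trans (ler_norm _) _.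
  by rewrite normrM normr_sign mul1r.
exists (\max_u M0 u); split; first by lra.
move=> M MM0; set typ := (X in _ <= \sum_(x | X x) _).
pose P (x : {ffun 'I_M -> X}) := \prod_i p (val (x i)).
have P0 x : 0 <= P x by exact: prodr_ge0.
have total : \sum_x P x = s ^+ M.
  rewrite -(bigA_distr_bigA (fun (i : 'I_M) (t : X) => p (val t))) /=.
  by rewrite prodr_const card_ord sE.
have bad : \sum_(x | ~~ typ x) P x <=
    \sum_u \sum_(x : {ffun 'I_M -> X} | tau * M%:R < \sum_i g u (x i)) P x.
  rewrite (exchange_big_dep (fun=> true)) //= [leRHS](bigID typ) /= -[leLHS]add0r.
  apply: lerD; first by rewrite sumr_ge0 // => x _; rewrite sumr_ge0.
  apply: ler_sum => x; rewrite negb_forall => /existsP[j].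
  rewrite -ltNge => xj.
  pose b := \sum_i (F (val (x i)) 0 j)%:~R - M%:R * m j < 0.
  rewrite (bigD1 (j, b)) /=; first by rewrite lerDl sumr_ge0.
  rewrite /g /= -mulr_sumr sumrB sumr_const card_ord -[m j *+ M]mulr_natl.
  move: xj; have [h|h] := boolP b; first by rewrite (ltr0_norm h) /= expr1 mulN1r.
  by rewrite /b -leNgt in h; rewrite (ger0_norm h) /= expr0 mul1r.
have bad' : \sum_u \sum_(x : {ffun 'I_M -> X} | tau * M%:R < \sum_i g u (x i)) P x
    <= s ^+ M / 2.
  apply: (@le_trans _ _ (\sum_(u : 'I_r * bool) delta * s ^+ M)).
    by apply: ler_sum => u _; apply: M0P; apply: leq_trans MM0; apply: leq_bigmax.
  rewrite sumr_const card_prod card_ord card_bool -[(_ * _) *+ _]mulr_natl mulrA [leRHS]mulrC.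
  rewrite ler_wpM2r ?exprn_ge0 ?(ltW s0) // natrM /delta ler_pdivrMr ?mulr_gt0 //.
  have : (r%:R : R) <= r.+1%:R by rewrite ler_nat.
  lra.
move: total; rewrite (bigID typ) /=; rewrite /P in bad bad' *; lra.
Qed.

Lemma shell_mass_ge (n : nat -> 'rV[int]_r) :
    (forall tau : R, 0 < tau -> exists N0, forall N, (N0 <= N)%N ->
      forall j, `|(n N 0 j)%:~R - N%:R * m j| <= tau * N%:R) ->
  forall eta : R, 0 < eta -> exists N1, forall N, (N1 <= N)%N ->
    exists2 Y : {fset {ffun 'I_N -> L}},
      (forall y, y \in Y -> \sum_i F (y i) = n N) &
      expR (- (eta * N%:R)) <= \sum_(y <- Y) \prod_i p (y i).
Proof.
move=> n_dev eta eta0.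
have [c c0 [K0 K0P]] := sums_near_mean F0 F_gen p_gt0 sum_p_le1 m_approx.
(* Cost per completing coordinate: a vector within [c K] of [K m] has weight at least
   [exp(- K C1)]. *)
pose C1 := zeta + \sum_j `|lam 0 j| * (`|m j| + c).
have C10 : 0 <= C1.
  by rewrite addr_ge0 // sumr_ge0 // => j _; rewrite mulr_ge0 // addr_ge0 // ltW.
(* Large enough that [K C1 <= eta N / 4]; moreover [D >= 2], so [K <= N/2] and [M] grows with
   [N]. *)
pose D := (Num.trunc (4%:R * C1 / eta)).+2.
have DC1 : 4%:R * C1 <= eta * D%:R.
  rewrite -ler_pdivrMl // [leLHS]mulrC; apply: (@le_trans _ _ D.-1%:R).
    apply: ltW; rewrite -truncn_lt_nat; first by rewrite /D.
    by rewrite divr_ge0 ?mulr_ge0 // ltW.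
  by rewrite ler_nat.
have D0 : 0 < D%:R :> R by rewrite ltr0n.
(* As [N <= 2 K D], deviations of order [tau N] stay within the tolerance [c K] of the
   completion. *)
pose tau := c / (8%:R * D%:R); have tau0 : 0 < tau by rewrite divr_gt0 ?mulr_gt0.
have rho1 : expR (- (eta / 4%:R)) < 1 by rewrite expR_lt1 oppr_lt0 divr_gt0.
have [X [M0 [rhoX typX]]] := typical_mass_ge tau0 rho1.
have [N0 N0P] := n_dev _ tau0.
exists (maxn (maxn N0 (2 * M0)) (maxn (K0.+1 * D) (Num.trunc (4%:R / eta)).+1)) => N.
rewrite !geq_max => /andP[/andP[N0N M0N] /andP[DK0N etaN]].
have N4 : 4%:R <= eta * N%:R.
  rewrite mulrC -ler_pdivrMr //; apply: ltW.
  by rewrite -truncn_lt_nat // divr_ge0 // ltW.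
pose K := (N %/ D)%N; pose M := (N - K)%N.
have DK : (K * D <= N)%N by exact: leq_trunc_div.
have NDK : (N < K.+1 * D)%N by exact: ltn_ceil.
have K0K : (K0 < K)%N by rewrite leq_divRL.
have NMK : N = (M + K)%N by rewrite subnK // leq_div.
have KN2 : (2 * K <= N)%N by apply: leq_trans DK; rewrite mulnC leq_mul2l orbT.
have M0M : (M0 <= M)%N.
  by rewrite leq_subRL ?leq_div // -(leq_pmul2l (isT : 0 < 2)%N) mulnDr
     [leqRHS]mul2n -addnn leq_add.
have NK : N%:R <= 2 * K%:R * D%:R :> R.
  rewrite -!natrM ler_nat; apply: leq_trans (ltnW NDK) _.
  by rewrite leq_mul2r mul2n -addnn -add1n leq_add2r (leq_ltn_trans _ K0K) ?orbT.
have KDN : K%:R * D%:R <= N%:R :> R by rewrite -natrM ler_nat.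
have tauN : 4%:R * (tau * N%:R) <= c * K%:R.
  have -> : c * K%:R = 4%:R * (tau * (2 * K%:R * D%:R)).
    by rewrite /tau; field; rewrite gt_eqF.
  by rewrite ler_wpM2l // ler_wpM2l // ltW.
have NR : N%:R = M%:R + K%:R :> R by rewrite -natrD -NMK.
have MN : M%:R <= N%:R :> R by rewrite ler_nat leq_subr.
have [|x typx|Y YF YE] := @complete_configurations _ _ _ F p X N M K
    (fun x => [forall j, `|\sum_i (F (val (x i)) 0 j)%:~R - M%:R * m j| <= tau * M%:R])
    (n N) (expR (- (K%:R * C1))) NMK; first exact: p_ge0.
  pose v := n N - \sum_i F (val (x i)).
  have vj j : `|(v 0 j)%:~R - K%:R * m j| <= c * K%:R.
    have -> : (v 0 j)%:~R - K%:R * m j = ((n N 0 j)%:~R - N%:R * m j)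
        - (\sum_i (F (val (x i)) 0 j)%:~R - M%:R * m j).
      rewrite /v !mxE rmorphB /= summxE raddf_sum /= NR.
      by ring.
    apply: le_trans (ler_normB _ _) _; have := N0P N N0N j.
    have /forallP/(_ j) := typx.
    have := ler_wpM2l (ltW tau0) MN; have := mulr_ge0 (ltW tau0) (ler0n R N).
    move: tauN; lra.
  have [z zE] := K0P K v (ltnW K0K) vj; exists z; first by rewrite zE addrC subrK.
  rewrite prod_gibbs card_ord zE ler_expR /C1 mulrDr opprD lerD2l lerN2.
  rewrite mulr_sumr; apply: ler_sum => j _; apply: le_trans (ler_norm _) _.
  rewrite normrM mulrCA ler_wpM2l //.
  have : `|(v 0 j)%:~R| <= `|(v 0 j)%:~R - K%:R * m j| + `|K%:R * m j|.
    by rewrite -{1}[(v 0 j)%:~R](subrK (K%:R * m j)) ler_normD.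
  rewrite normrM normr_nat; have := vj j; lra.
exists Y => //; apply: le_trans YE.
set s := \sum_(t <- X) p t in rhoX typX.
apply: (@le_trans _ _ (expR (- (K%:R * C1)) * (s ^+ M / 2))); last first.
  by rewrite ler_wpM2l ?expR_ge0 // typX.
(* The exponent is shared between the completion, the mass [s ^+ M] and the factor [1/2], the last
   being covered by [eta N >= 4]. *)
have -> : - (eta * N%:R) = - (eta / 4%:R * N%:R) + (- (eta / 4%:R * N%:R)
    - (eta / 2 * N%:R)) by lra.
rewrite !expRD; apply: ler_pM; rewrite ?expR_ge0 ?mulr_ge0 ?expR_ge0 //.
  rewrite ler_expR lerN2.
  have := ler_wpM2l (ler0n R K) DC1; have := ler_wpM2l (ltW eta0) KDN; lra.
apply: ler_pM; rewrite ?expR_ge0 //.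
  apply: (@le_trans _ _ (expR (- (eta / 4%:R)) ^+ M)).
    rewrite -expRM_natl ler_expR mulrN lerN2 mulrC ler_wpM2l //.
    by rewrite divr_ge0 // ltW.
  by apply: lerXn2r; rewrite ?nnegrE ?expR_ge0 // (le_trans (expR_ge0 _) rhoX).
rewrite expRN lef_pV2 ?posrE ?expR_gt0 //.
apply: le_trans (expR_ge1Dx _); lra.
Qed.

End LowerBound.

(** * Marginals of the uniform measure *)

(** Jensen by the tangent line at the mean [a], whose linear part sums to 0. *)
Lemma expR_mean_le (R : realType) (T : Type) (s : seq T) (f : T -> R) :
  (0 < size s)%N ->
  (size s)%:R * expR ((\sum_(x <- s) f x) / (size s)%:R) <= \sum_(x <- s) expR (f x).
Proof.
move=> s0; have n0 : 0 < (size s)%:R :> R by rewrite ltr0n.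
set a := _ / _.
have -> : (size s)%:R * expR a = \sum_(x <- s) expR a * (1 + (f x - a)).
  rewrite -mulr_sumr big_split sumrB /= !big_const_seq !iter_addr_0 count_predT.
  rewrite mulrC -[a *+ _]mulr_natr /a divfK ?gt_eqF // subrr addr0 //.
apply: ler_sum => x _.
have -> : expR (f x) = expR a * expR (f x - a) by rewrite -expRD addrC subrK.
by rewrite ler_wpM2l ?expR_ge0 ?expR_ge1Dx.
Qed.

Section ProductMass.
Variables (R : realType) (L : zmodType) (p : L -> R).
Hypothesis p_ge0 : forall x, 0 <= p x.
Hypothesis sum_p_le1 : forall X : {fset L}, \sum_(x <- X) p x <= 1.

Lemma sum_fset_prod_le1 k (Y : {fset {ffun 'I_k -> L}}) :
  \sum_(y <- Y) \prod_i p (y i) <= 1.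
Proof.
have [|X] := @sum_fset_ffun_le _ _ _ Y (fun y => \prod_i p (y i)).
  by move=> y; exact: prodr_ge0.
move=> /le_trans; apply.
under eq_bigr => f _ do under eq_bigr => i _ do rewrite ffunE.
rewrite -(bigA_distr_bigA (fun _ (t : X) => p (val t))) /=.
by apply: prodr_ile1 => i _; rewrite sumr_ge0 //= -(big_seq_fsetE _ X predT p) sum_p_le1.
Qed.

Section Events.
Variables (k : nat) (A : set {ffun 'I_k -> L}).

Lemma product_pmf_ge0 y : 0 <= product_pmf p k y.
Proof. exact: prodr_ge0. Qed.

Let fin (B : set {ffun 'I_k -> L}) :
  (\esum_(y in B) (product_pmf p k y)%:E \is a fin_num)%E.
Proof.
by apply: (esum_fin_num product_pmf_ge0 (M := 1)) => X _; exact: sum_fset_prod_le1.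
Qed.

Lemma sum_le_prob_of (Y : {fset {ffun 'I_k -> L}}) : [set` Y] `<=` A ->
  \sum_(y <- Y) \prod_i p (y i) <= prob_of (product_pmf p k) A.
Proof.
move=> YA; rewrite -lee_fin /prob_of fineK ?fin //.
exact: (fset_le_esum (product_pmf p k) YA).
Qed.

Lemma prob_of_ge0 : 0 <= prob_of (product_pmf p k) A.
Proof.
by rewrite fine_ge0 // esum_ge0 // => y _; rewrite lee_fin product_pmf_ge0.
Qed.

Lemma prob_of_setC : prob_of (product_pmf p k) A + prob_of (product_pmf p k) (~` A) <= 1.
Proof.
have pT : forall y, [set: {ffun 'I_k -> L}] y -> (0 <= (product_pmf p k y)%:E)%E.
  by move=> y _; rewrite lee_fin product_pmf_ge0.
have := @esumID _ _ A setT (fun y => (product_pmf p k y)%:E) pT; rewrite !setTI => E.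
rewrite -fineD ?fin // -E -lee_fin fineK ?fin //.
by apply: esum_le_bound => X _; exact: sum_fset_prod_le1.
Qed.

End Events.

Lemma sum_ffun_event_le (k : nat) (A : set {ffun 'I_k -> L}) (X : {fset L}) :
  \sum_(z : {ffun 'I_k -> X}) (\prod_j p (val (z j))) * ([ffun j => val (z j)] \in A)%:R
  <= prob_of (product_pmf p k) A.
Proof.
pose phi (z : {ffun 'I_k -> X}) : {ffun 'I_k -> L} := [ffun j => val (z j)].
have phi_inj : injective phi.
  move=> z z' /ffunP e; apply/ffunP => j; apply: val_inj.
  by have := e j; rewrite !ffunE.
pose s := [seq phi z | z <- index_enum {ffun 'I_k -> X} & phi z \in A].
apply: (@le_trans _ _ (\sum_(y <- [fset y in s]%fset) \prod_j p (y j))); last first.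
  apply: sum_le_prob_of => y /=; rewrite !inE => /mapP[z].
  by rewrite mem_filter => /andP[/set_mem zA _] ->.
apply: (@le_trans _ _ (\sum_(y <- s) \prod_j p (y j))).
  rewrite big_map big_filter /= [leRHS]big_mkcond /=; apply: ler_sum => z _.
  have -> : \prod_j p (phi z j) = \prod_j p (val (z j)).
    by apply: eq_bigr => j _; rewrite ffunE.
  by rewrite -/(phi z); case: (phi z \in A); rewrite ?mulr1 ?mulr0.
apply: ler_sum_uniq => [y||y]; first exact: prodr_ge0.
  by rewrite map_inj_uniq ?filter_uniq ?index_enum_uniq.
by rewrite !inE.
Qed.

(** * Disjoint blocks of coordinates and cyclic shifts *)

Section Blocks.
Variables (N' k : nat) (A : set {ffun 'I_k -> L}).
Local Notation N := N'.+1.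
Let P := prob_of (product_pmf p k) A.
Let B := (N %/ k)%N.

(** Addition in ['I_N] is modulo [N], so this is a rotation; the group structure is why [N] is a
    successor. Exchangeability enters only through these rotations. *)
Definition shift (c : 'I_N) (y : {ffun 'I_N -> L}) := [ffun i => y (i + c)].

Let beta (b : 'I_B) (j : 'I_k) : 'I_N := inord (b * k + j).

Let beta_lt (b : 'I_B) (j : 'I_k) : (b * k + j < N)%N.
Proof.
apply: (@leq_trans (b.+1 * k)); first by rewrite mulSn addnC ltn_add2r.
by apply: leq_trans (leq_trunc_div N k); rewrite leq_mul2r ltn_ord orbT.
Qed.

Let beta_inj b j b' j' : beta b j = beta b' j' -> b = b' /\ j = j'.
Proof.
move=> /(congr1 val); rewrite /= !inordK ?beta_lt // => e.
have k0 : (0 < k)%N := leq_ltn_trans (leq0n j) (ltn_ord j).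
have bb' : b = b' :> nat.
  by have := congr1 (divn^~ k) e; rewrite /= !divnMDl // !divn_small ?addn0.
split; apply: val_inj => //=; apply/eqP.
by rewrite -(eqn_add2l (b * k)) {2}bb' e.
Qed.

(** Block [b] is the first block of a rotated configuration; its indices stay below [N], so there is
    no wrap-around. *)
Lemma proj_first_shift (b : 'I_B) y :
  proj_first k N (shift (inord (b * k)) y) = [ffun j => y (beta b j)].
Proof.
apply/ffunP => j; rewrite !ffunE; have jN := beta_lt b j.
have jN' : (j < N)%N by apply: leq_ltn_trans jN; exact: leq_addl.
rewrite insubT /= ffunE; congr (y _); apply: val_inj => /=.
rewrite !inordK ?(leq_ltn_trans (leq_addr j _) jN) // addnC.
by rewrite modn_small.
Qed.

Lemma sum_fset_blocks_le (Y : {fset {ffun 'I_N -> L}}) (theta : R) :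
  0 < theta <= 2^-1 ->
  \sum_(y <- Y) (\prod_i p (y i)) *
    expR (theta * \sum_(b < B) ((proj_first k N (shift (inord (b * k)) y) \in A)%:R - P))
  <= expR (2 * theta ^+ 2 * B%:R).
Proof.
move=> /andP[theta0 theta2].
have P0 : 0 <= P by exact: prob_of_ge0.
have P1 : P <= 1.
  have := prob_of_setC A; have := prob_of_ge0 (~` A); rewrite -/P; lra.
pose h (z : {ffun 'I_k -> L}) := expR (theta * ((z \in A)%:R - P)).
have [|X] := @sum_fset_ffun_le _ _ _ Y (fun y => (\prod_i p (y i)) *
    expR (theta * \sum_(b < B) ((proj_first k N (shift (inord (b * k)) y) \in A)%:R - P))).
  by move=> y; rewrite mulr_ge0 ?expR_ge0 ?prodr_ge0.
move=> /le_trans; apply.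
have sumX1 : \sum_(x : X) p (val x) <= 1.
  by have := sum_p_le1 X; rewrite big_seq_fsetE.
pose hX (z : {ffun 'I_k -> X}) := h [ffun j => val (z j)].
apply: (@le_trans _ _ (\sum_(f : {ffun 'I_N -> X}) (\prod_i p (val (f i))) *
    \prod_b hX [ffun j => f (beta b j)])).
  apply: ler_sum => f _; rewrite le_eqVlt; apply/orP; left; apply/eqP.
  congr (_ * _); first by apply: eq_bigr => i _; rewrite ffunE.
  rewrite mulr_sumr expR_sum; apply: eq_bigr => b _; rewrite proj_first_shift.
  rewrite /hX; have -> : [ffun j => val ([ffun j0 => f (beta b j0)] j)] =
      [ffun j => [ffun i => val (f i)] (beta b j)] :> {ffun 'I_k -> L}.
    by apply/ffunP => j; rewrite !ffunE.
  by [].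
apply: le_trans (sum_blocks_le (p := fun x : X => p (val x)) beta_inj _ _ _) _ => //.
  by move=> z; exact: expR_ge0.
rewrite [in leRHS]mulrC expRM_natl.
apply: lerXn2r; rewrite ?nnegrE ?expR_ge0 //.
  by rewrite sumr_ge0 // => z _; rewrite mulr_ge0 ?expR_ge0 ?prodr_ge0.
apply: le_trans (expR_ge1Dx _).
pose w (z : {ffun 'I_k -> X}) := \prod_j p (val (z j)).
have w0 z : 0 <= w z by exact: prodr_ge0.
have sum_w : \sum_z w z <= 1.
  rewrite -(bigA_distr_bigA (fun (j : 'I_k) (x : X) => p (val x))) /=.
  by apply: prodr_ile1 => j _; rewrite sumr_ge0.
(* The constant part has a nonnegative coefficient, so total mass at most 1 can be used there; the
   event part is at most [theta * P], which cancels and leaves [1 + 2 theta^2]. *)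
apply: (@le_trans _ _ ((1 + 2 * theta ^+ 2 - theta * P) * \sum_z w z +
    theta * \sum_z w z * ([ffun j => val (z j)] \in A)%:R)).
  rewrite !mulr_sumr -big_split; apply: ler_sum => z _ /=.
  set i : R := (_ \in A)%:R.
  rewrite [leRHS](_ : _ = w z * (1 + theta * (i - P) + 2 * theta ^+ 2)); last by ring.
  rewrite -/(w z) ler_wpM2l ?w0 // /hX /h -/i.
  have i01 : 0 <= i <= 1 by rewrite /i; case: (_ \in _); rewrite ?lexx ?ler01.
  have /andP[i0 i1] := i01.
  have u : theta * (i - P) <= 2^-1 by nra.
  apply: le_trans (expR_le_quadratic u) _; rewrite lerD2l exprMn ler_pM2l //.
  rewrite ler_piMr ?sqr_ge0 //; nra.
have := sum_ffun_event_le A X; rewrite -/P -/w => SA.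
have : 0 <= 1 + 2 * theta ^+ 2 - theta * P by have := sqr_ge0 theta; nra.
have := ler_wpM2l (ltW theta0) SA; nra.
Qed.

Section Uniform.
Variables (Gamma : set {ffun 'I_N -> L}) (W : R).
Hypothesis weight_Gamma : forall y, Gamma y -> \prod_i p (y i) = W.
Hypothesis W_gt0 : 0 < W.
Hypothesis shift_Gamma : forall c y, Gamma y -> Gamma (shift c y).

(** Each point has weight [W] and the total mass is at most 1, so there are at most [1/W] points. *)
Lemma finite_constant_weight : finite_set Gamma.
Proof.
apply: contrapT => /(infinite_set_fset (Num.trunc W^-1).+1)[Y YG nY].
have := sum_fset_prod_le1 Y; rewrite leNgt => /negP; apply.
rewrite big_seq (eq_bigr (fun=> W)) => [|y yY]; last exact: weight_Gamma (YG _ yY).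
rewrite -big_seq big_const_seq iter_addr_0 count_predT -[_ *+ _]mulr_natr.
rewrite -ltr_pdivrMl // mulr1; apply: (@lt_le_trans _ _ (Num.trunc W^-1).+1%:R).
  by rewrite -truncn_lt_nat // invr_ge0 ltW.
by rewrite ler_nat.
Qed.

Let G := fset_set Gamma.

Let mem_G y : y \in G <-> Gamma y.
Proof.
rewrite /G in_fset_set; last exact: finite_constant_weight.
by rewrite inE.
Qed.

Let sum_shift c (g : {ffun 'I_N -> L} -> R) :
  \sum_(y <- G) g (shift c y) = \sum_(y <- G) g y.
Proof.
have shiftK c' : cancel (shift c') (shift (- c')).
  by move=> y; apply/ffunP => i; rewrite !ffunE subrK.
have shiftK' c' : cancel (shift (- c')) (shift c').
  by move=> y; apply/ffunP => i; rewrite !ffunE addrK.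
rewrite -(big_map (shift c) predT g); apply: perm_big.
apply: uniq_perm; rewrite ?(map_inj_uniq (can_inj (shiftK c))) ?fset_uniq //.
move=> y; apply/mapP/idP => [[z zG ->]|yG].
  by apply/mem_G/shift_Gamma/mem_G.
exists (shift (- c) y); last by rewrite shiftK'.
by apply/mem_G/shift_Gamma/mem_G.
Qed.

Let card_event (A' : set {ffun 'I_N -> L}) :
  #|` fset_set (A' `&` Gamma)|%:R = \sum_(y <- G) (y \in A')%:R :> R.
Proof.
rewrite -natr_sum; congr (_%:R).
transitivity (count (fun y => y \in A') G); last first.
  by rewrite -sum1_count big_mkcond; apply: eq_bigr => y _; case: (y \in A').
have fin : finite_set (A' `&` Gamma) by apply/finite_setIr/finite_constant_weight.
rewrite -size_filter; apply: perm_size; apply: uniq_perm; rewrite ?filter_uniq ?fset_uniq //.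
move=> y; rewrite mem_filter in_fset_set // in_setI; congr (_ && _).
by apply/idP/idP; rewrite inE => /mem_G.
Qed.

Variables (theta kappa : R).
Hypothesis theta_itv : 0 < theta <= 2^-1.
Hypothesis mass_ge : exists2 Y : {fset {ffun 'I_N -> L}}, [set` Y] `<=` Gamma &
  expR (- kappa) <= \sum_(y <- Y) \prod_i p (y i).

(** The right-hand side is the product mass of [Gamma]. *)
Let n_gt0 : expR (- kappa) <= #|` G|%:R * W.
Proof.
have [Y YG /le_trans] := mass_ge; apply.
apply: (@le_trans _ _ (\sum_(y <- G) \prod_i p (y i))).
  apply: ler_sum_uniq => [y||y yY]; [exact: prodr_ge0 | exact: fset_uniq |].
  by apply/mem_G/YG.
rewrite big_seq (eq_bigr (fun=> W)) => [|y /mem_G]; last exact: weight_Gamma.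
by rewrite -big_seq big_const_seq iter_addr_0 count_predT -[W *+ _]mulr_natl.
Qed.

Let card_gt0 : 0 < #|` G|%:R :> R.
Proof.
by rewrite -(pmulr_lgt0 _ W_gt0) (lt_le_trans _ n_gt0) // expR_gt0.
Qed.

Lemma push_uniform_setC :
  push (proj_first k N) (uniform_on R Gamma) A
  + push (proj_first k N) (uniform_on R Gamma) (~` A) = 1.
Proof.
rewrite /push /uniform_on -mulrDl !card_event -big_split /=.
rewrite (eq_bigr (fun=> 1)) => [|y _].
  by rewrite big_const_seq iter_addr_0 count_predT divff // gt_eqF.
rewrite preimage_setC in_setC; case: (_ \in _); rewrite ?addr0 ?add0r //.
Qed.

(** By rotation invariance [f] has average [theta B (mu - P)] over [Gamma]. Jensen bounds its
    exponential by an average, which is a product-weight sum divided by the mass of [Gamma]; take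
    logarithms. *)
Lemma push_uniform_le :
  theta * B%:R * (push (proj_first k N) (uniform_on R Gamma) A - P)
  <= 2 * theta ^+ 2 * B%:R + kappa.
Proof.
set mu := push _ _ A.
pose f y := theta * \sum_(b < B) ((proj_first k N (shift (inord (b * k)) y) \in A)%:R - P).
have sum_f : \sum_(y <- G) f y = #|` G|%:R * (theta * B%:R * (mu - P)).
  rewrite -mulr_sumr exchange_big /=.
  rewrite (eq_bigr (fun=> #|` G|%:R * (mu - P))) => [|b _].
    by rewrite sumr_const card_ord -[_ *+ B]mulr_natl; ring.
  rewrite sumrB (sum_shift _ (fun y => (proj_first k N y \in A)%:R)).
  rewrite big_const_seq iter_addr_0 count_predT -[P *+ _]mulr_natl mulrBr.
  congr (_ - _); rewrite /mu /push /uniform_on card_event mulrC divfK ?gt_eqF //.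
have size0 : (0 < size G)%N by rewrite -(ltr_nat R).
have := expR_mean_le f size0; rewrite sum_f mulrAC divff ?gt_eqF // mul1r => mean_f.
have := sum_fset_blocks_le G theta_itv.
rewrite big_seq (eq_bigr (fun y => W * expR (f y))) => [|y /mem_G yG]; last first.
  by rewrite weight_Gamma.
rewrite -big_seq -mulr_sumr => WE.
have := le_trans (ler_wpM2l (ltW W_gt0) mean_f) WE; rewrite mulrA [W * _]mulrC => E.
have := le_trans (ler_wpM2r (expR_ge0 _) n_gt0) E.
rewrite -expRD ler_expR; lra.
Qed.

End Uniform.

End Blocks.
End ProductMass.

(** * From bounds on events to total variation, and the conclusion *)

Lemma tv_dist_le (R : realType) (T : choiceType) (mu nu : set T -> R) (eps : R) :
  (forall A, `|mu A - nu A| <= eps) -> 0 <= tv_dist mu nu <= eps.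
Proof.
move=> munu; have ne : [set `|mu A - nu A| | A in [set: set T]] !=set0.
  by exists `|mu set0 - nu set0|, set0.
have ub : ubound [set `|mu A - nu A| | A in [set: set T]] eps by move=> _ [A _ <-].
apply/andP; split; last exact: ge_sup.
apply: (@le_trans _ _ `|mu set0 - nu set0|) => //.
by apply: sup_upper_bound; [split=> //; exists eps | exists set0].
Qed.

Theorem theorem10 (R : realType)
  (d : nat) (d_ge1 : (1 <= d)%N)
  (L : zmodType) (e : 'I_d -> L) (e_basis : is_Zbasis [set: L] e)
  (V : vectType R) (iota : {additive L -> V})
  (V_ext : is_extension_of_scalars iota e)
  (ip : {dot V for idfun})
  (r : nat) (a : 'I_r -> R) (a_basis : is_Zbasis (energy_group iota ip) a)
  (F : L -> 'rV[int]_r)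
  (F_def : forall x, energy iota ip x = \sum_j a j * (F x 0 j)%:~R)
  (lam : 'rV[R]_r) (lam_D : Ddomain iota F lam)
  (F_gen : generated_subgroup (range F) = [set: 'rV[int]_r])
  (lamN : nat -> 'rV[R]_r)
  (lamN_D : forall N, (1 <= N)%N -> Ddomain iota F (lamN N))
  (lamN_cvg : lamN N @[N --> \oo] --> lam)
  (n : nat -> 'rV[int]_r)
  (reachable : forall N, (1 <= N)%N -> shell iota ip N (shell_energy a (n N)) !=set0)
  (n_mean : forall j : 'I_r,
     (fun N : nat => (n N 0 j)%:~R - N%:R * mean F (lamN N) 0 j)
       =O_\oo (fun=> 1 : R^o))
  (k : nat) (k_ge1 : (1 <= k)%N) :
  tv_dist (push (proj_first k N)
             (uniform_on R (shell iota ip N (shell_energy a (n N)))))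
          (prob_of (product_pmf (gibbs F lam) k))
    @[N --> \oo] --> (0 : R).
Proof.
have F0 := energy_form0 a_basis F_def.
have [C C0 FC] := energy_form_le_Qform e_basis V_ext a_basis F_def lam_D.
have Q0 := Qform_ge0 lam_D.
have sumQ := sum_expR_Qform_bounded e_basis V_ext lam_D.
have Z1 := partition_function_ge1 F0 Q0 sumQ.
have p_ge0 := gibbs_ge0 F0 Q0 sumQ.
have p_le1 := sum_gibbs_le1 F0 Q0 sumQ.
pose m j := mean F lam 0 j; pose zeta := ln (partition_function F lam).
have zeta0 : 0 <= zeta by exact: ln_ge0.
have pE x : gibbs F lam x = expR (- zeta - Qform F lam x).
  by rewrite expRD expRN lnK // posrE (lt_le_trans ltr01).
(* Half of [tau] absorbs the bounded error around [N m(lamN N)], the other half the convergence of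
   the means. *)
have n_dev (tau : R) : 0 < tau -> exists N0, forall N, (N0 <= N)%N ->
    forall j, `|(n N 0 j)%:~R - N%:R * m j| <= tau * N%:R.
  move=> tau0; suff : \forall N \near \oo, forall j,
      `|(n N 0 j)%:~R - N%:R * m j| <= tau * N%:R.
    by move=> [N0 _ N0P]; exists N0.
  apply: filter_forall => j.
  have /eqO_exP[c c0 nc] := n_mean j.
  have tau2 : 0 < tau / 2 by rewrite divr_gt0.
  have /cvgrPdist_le/(_ _ tau2) mj := mean_cvg F0 Q0 sumQ C0 FC lamN_cvg (j := j).
  near=> N.
  have h1 : `|(n N 0 j)%:~R - N%:R * mean F (lamN N) 0 j| <= c * `|1 : R^o|.
    by near: N.
  rewrite normr1 mulr1 in h1.
  have h2 : `|m j - mean F (lamN N) 0 j| <= tau / 2 by near: N.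
  have h3 : c / (tau / 2) <= N%:R.
    apply: ltW; rewrite -truncn_lt_nat; last by apply: divr_ge0; apply: ltW.
    by near: N; exact: nbhs_infty_gt.
  have -> : (n N 0 j)%:~R - N%:R * m j =
      ((n N 0 j)%:~R - N%:R * mean F (lamN N) 0 j)
      - N%:R * (m j - mean F (lamN N) 0 j) by ring.
  apply: le_trans (ler_normB _ _) _; rewrite normrM normr_nat.
  rewrite ler_pdivrMr // in h3.
  have := ler_wpM2l (ler0n R N) h2; lra.
have mass := shell_mass_ge F0 F_gen zeta0 pE p_le1
  (sum_gibbs_approx F0 Q0 sumQ) (mean_approx F0 Q0 sumQ C0 FC) n_dev.
apply/cvgrPdist_le => eps eps0.
pose theta := Num.min (2^-1) (eps / 3%:R).
have theta0 : 0 < theta by rewrite lt_min invr_gt0 divr_gt0 ?ltr0n.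
have theta2 : theta <= 2^-1 by rewrite ge_min lexx.
have theta_eps : 3%:R * theta <= eps.
  by rewrite mulrC -ler_pdivlMr // ge_min lexx orbT.
(* With [N <= 2 k B] this makes [eta N <= theta^2 B], so the excess on any event is at most
   [2 theta + theta = 3 theta], which is at most [eps]. *)
pose eta := theta ^+ 2 / (2 * k%:R).
have k0 : 0 < k%:R :> R by rewrite ltr0n.
have eta0 : 0 < eta by rewrite divr_gt0 ?exprn_gt0 ?mulr_gt0.
have [N1 N1P] := mass _ eta0.
(* Taking [N > k] excludes [N = 0] and provides at least one block. *)
exists (maxn N1 k.+1) => // -[|N'] /=; rewrite geq_max => /andP[N1N kN] //.
have [Y YF YE] := N1P _ N1N.
set Gamma := shell _ _ _ _; rewrite sub0r normrN.
(* An upper bound on every event suffices: applied to the complement, it gives the lower bound. *)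
suff main (A : set {ffun 'I_k -> L}) : push (proj_first k N'.+1) (uniform_on R Gamma) A
      - prob_of (product_pmf (gibbs F lam) k) A <= 3%:R * theta
    /\ push (proj_first k N'.+1) (uniform_on R Gamma) A
       + push (proj_first k N'.+1) (uniform_on R Gamma) (~` A) = 1.
  have bound (A : set {ffun 'I_k -> L}) :
      `|push (proj_first k N'.+1) (uniform_on R Gamma) A
        - prob_of (product_pmf (gibbs F lam) k) A| <= eps.
    have [le1 sum1] := main A; have [le2 _] := main (~` A).
    have := prob_of_setC p_ge0 p_le1 A.
    rewrite ler_norml => ?; apply/andP; split; lra.
  by have /andP[tv0 tv1] := tv_dist_le bound; rewrite ger0_norm.
have GammaE := shellE a_basis F_def (n N'.+1).
pose W := expR (- (#|'I_N'.+1|%:R * zeta) - \sum_j lam 0 j * (n N'.+1 0 j)%:~R).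
have weight y : Gamma y -> \prod_i gibbs F lam (y i) = W.
  by move=> /GammaE yn; rewrite (prod_gibbs pE) yn.
have shiftG c y : Gamma y -> Gamma (shift c y).
  move=> /GammaE yn; apply/GammaE; rewrite -yn.
  by rewrite [RHS](reindex_inj (addIr c)); apply: eq_bigr => i _; rewrite ffunE.
have theta_itv : 0 < theta <= 2^-1 by rewrite theta0.
have massY : exists2 Y : {fset {ffun 'I_N'.+1 -> L}}, [set` Y] `<=` Gamma &
    expR (- (eta * N'.+1%:R)) <= \sum_(y <- Y) \prod_i gibbs F lam (y i).
  by exists Y => // y /YF yn; apply/GammaE.
split; last first.
  exact: (push_uniform_setC p_ge0 p_le1 A weight (expR_gt0 _) massY).
have := push_uniform_le p_ge0 p_le1 A weight (expR_gt0 _) shiftG theta_itv massY.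
set B := (N'.+1 %/ k)%N => le_mu.
have B0 : 0 < B%:R :> R by rewrite ltr0n divn_gt0 // ltnW.
have NB : N'.+1%:R <= 2 * k%:R * B%:R :> R.
  rewrite -!natrM ler_nat; apply: leq_trans (ltnW (ltn_ceil N'.+1 k_ge1)) _.
  rewrite -/B mulnAC leq_mul2r mul2n -addnn -add1n leq_add2r divn_gt0 //.
  by rewrite (ltnW kN) orbT.
have etaN : eta * N'.+1%:R <= theta ^+ 2 * B%:R.
  have -> : theta ^+ 2 * B%:R = eta * (2 * k%:R * B%:R).
    by rewrite /eta; field; rewrite gt_eqF.
  by rewrite ler_wpM2l // ltW.
rewrite -(ler_pM2l (mulr_gt0 theta0 B0)); apply: le_trans le_mu _.
have -> : theta * B%:R * (3%:R * theta) = 3%:R * (theta ^+ 2 * B%:R) by ring.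
lra.
Unshelve. all: by end_near.
Qed.
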